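(* Let $(g_L,Z,\lambda,\rho)$ be a Lyra almost Ricci--Bourguignon soliton on a Lyra twisted warped product $M=M_1\times_fM_2$ with scale $\varphi$, where $Z=Z_1+Z_2$ is projectable. Put $k=\ln f$, $\sigma=\ln\varphi$ and assume $\sigma=\sigma_2$ and $k=k_1+k_2$ with $k_1\in C^\infty(M_1)$, $k_2,\sigma_2\in C^\infty(M_2)$. For $x\in M_1$ let $h_{2,x}=e^{2k_1(x)}e^{2(k_2+\sigma_2)}g_2$ be the metric induced by $g_L$ on $\{x\}\times M_2\cong M_2$, with Ricci tensor $\operatorname{Ric}_{h_{2,x}}$ and scalar curvature $R_{h_{2,x}}$. Define $$\mathcal C_2=\operatorname{Hess}_2\sigma_2-(dk_2\otimes d\sigma_2+d\sigma_2\otimes dk_2)-d\sigma_2\otimes d\sigma_2,$$ $$c_2=\langle\nabla_2k_2,\nabla_2\sigma_2\rangle_{g_2}+|\nabla_2\sigma_2|_{g_2}^2,\qquad a_1=\Delta_1k_1+n_2|\nabla_1k_1|_{g_1}^2 .$$ For each fixed $x\in M_1$, the fiber slice $(M_2,h_{2,x},Z_2)$ inherits an almost Ricci--Bourguignon soliton structure with parameter $\rho$ (that is, there is $\lambda_{2,x}\in C^\infty(M_2)$ with $\operatorname{Ric}_{h_{2,x}}+\frac12\mathcal L_{Z_2}h_{2,x}=(\lambda_{2,x}+\rho R_{h_{2,x}})h_{2,x}$) if and only if $$\operatorname{tf}_{g_2}\mathcal C_2=0 .$$ If $\mathcal C_2=\gamma_2g_2$, then the inherited soliton function is $$\lambda_{2,x}=\lambda+\rho(R^L-R_{h_{2,x}})-Z_1(k_1)+e^{-2\sigma_2}f^{-2}\big[n_1\gamma_2+n_1c_2+f^2a_1\big],$$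 evaluated on the slice $\{x\}\times M_2$.
   Context: Lyra twisted warped product: $(M_1,g_1),(M_2,g_2)$ are smooth pseudo-Riemannian manifolds of positive dimensions $n_1,n_2$, $n=n_1+n_2$; $f,\varphi:M_1\times M_2\to(0,\infty)$ are smooth; $M=M_1\times M_2$ carries $g=g_1\oplus f^2g_2$ and $g_L=\varphi^2g=e^{2\sigma}g$. $\operatorname{Ric}^L,R^L$ are the Ricci tensor and scalar curvature of $g_L$. A Lyra almost Ricci--Bourguignon soliton is $(g_L,Z,\lambda,\rho)$ with $Z$ a vector field on $M$, $\lambda\in C^\infty(M)$, $\rho\in\mathbb R$, satisfying $\operatorname{Ric}^L+\frac12\mathcal L_Zg_L=(\lambda+\rho R^L)g_L$. $Z$ is projectable, $Z=Z_1+Z_2$, if $Z_1,Z_2$ are canonical lifts of vector fields on $M_1,M_2$ (denoted by the same letters). $\nabla_i,\operatorname{Hess}_i,\Delta_i$ (trace of Hessian) are those of $(M_i,g_i)$; $|v|^2=\langle v,v\rangle$. For a symmetric $(0,2)$-tensor $S$ on an $m$-dimensional $(N,h)$, $\operatorname{tf}_hS=S-\frac1m(\operatorname{tr}_hS)h$. *)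

(* Defs.v *)
From HB Require Import structures.
From mathcomp Require Import all_boot all_order all_algebra.
From mathcomp Require Import all_classical all_reals all_analysis.
Set Implicit Arguments.
Unset Strict Implicit.
Unset Printing Implicit Defensive.
Import Order.TTheory GRing.Theory Num.Theory.
Import numFieldNormedType.Exports.
Local Open Scope classical_set_scope.
Local Open Scope ring_scope.

Definition partial (R : realType) (n : nat) (i : 'I_n) (F : 'rV[R]_n -> R) :
  'rV[R]_n -> R := fun u => 'D_(delta_mx 0 i) F u.

(* C^oo on the open set U: every iterated partial derivative exists and is
   Frechet differentiable at every point of U.  The values of F outside U are
   irrelevant, since derivatives at a point of U depend on the germ only. *)
Definition smooth_on (R : realType) (n : nat) (U : set 'rV[R]_n)
    (F : 'rV[R]_n -> R) : Prop :=
  forall (s : seq 'I_n) (u : 'rV[R]_n), U u ->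
    differentiable (foldr (@partial R n) F s) u.

(* [chart_at] selects a chart around each point; it is used only to evaluate at
   a point scalar quantities that are computed in a chart and do not depend on
   that chart.  [chart_inv c] is meaningful on the image of [c] only. *)
Record charted (R : realType) (n : nat) := Charted {
  carrier :> topologicalType;
  atlas : Type;
  dom : atlas -> set carrier;
  chart : atlas -> carrier -> 'rV[R]_n;
  chart_inv : atlas -> 'rV[R]_n -> carrier;
  chart_at : carrier -> atlas }.

Definition img (R : realType) (n : nat) (M : charted R n) (c : atlas M) :
  set 'rV[R]_n := chart c @` dom c.

Definition trans (R : realType) (n : nat) (M : charted R n) (c d : atlas M) :
  'rV[R]_n -> 'rV[R]_n := fun u => chart d (chart_inv c u).

Record smooth_manifold (R : realType) (n : nat) (M : charted R n) : Prop := {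
  mfd_hausdorff : hausdorff_space M;
  mfd_second_countable : @second_countable M;
  mfd_dom_open : forall c : atlas M, open (dom c);
  mfd_img_open : forall c : atlas M, open (img c);
  mfd_chartK : forall (c : atlas M) (p : M), dom c p ->
    chart_inv c (chart c p) = p;
  mfd_chart_continuous : forall (c : atlas M) (p : M), dom c p ->
    {for p, continuous (chart c)};
  mfd_chart_inv_continuous : forall (c : atlas M) (u : 'rV[R]_n), img c u ->
    {for u, continuous (chart_inv c)};
  mfd_cover : forall p : M, dom (chart_at p) p;
  mfd_trans_smooth : forall (c d : atlas M) (a : 'I_n),
    smooth_on (chart c @` (dom c `&` dom d)) (fun u => trans c d u 0 a) }.

Definition mprod (R : realType) (n1 n2 : nat)
    (M1 : charted R n1) (M2 : charted R n2) : charted R (n1 + n2) :=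
  @Charted R (n1 + n2) (M1 * M2)%type (atlas M1 * atlas M2)%type
    (fun c => dom c.1 `*` dom c.2)
    (fun c p => row_mx (chart c.1 p.1) (chart c.2 p.2))
    (fun c u => (chart_inv c.1 (lsubmx u), chart_inv c.2 (rsubmx u)))
    (fun p => (chart_at p.1, chart_at p.2)).

Definition smooth_fun (R : realType) (n : nat) (M : charted R n) (F : M -> R) :
  Prop := forall c : atlas M, smooth_on (img c) (F \o chart_inv c).

(* A tensor field is given by its components in every chart of the atlas, as
   functions of the coordinates: a (0,2)-tensor by its matrix S_ij, a vector
   field by the row X^i, a 1-form by the row w_i.  Components matter on [img c]
   only, whence [field_eq] instead of Leibniz equality. *)
Definition tensor02 (R : realType) (n : nat) (M : charted R n) :=
  atlas M -> 'rV[R]_n -> 'M[R]_n.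
Definition vfield (R : realType) (n : nat) (M : charted R n) :=
  atlas M -> 'rV[R]_n -> 'rV[R]_n.
Definition oneform (R : realType) (n : nat) (M : charted R n) :=
  atlas M -> 'rV[R]_n -> 'rV[R]_n.

Definition field_eq (R : realType) (n : nat) (M : charted R n) (V : Type)
    (S T : atlas M -> 'rV[R]_n -> V) : Prop :=
  forall (c : atlas M) (u : 'rV[R]_n), img c u -> S c u = T c u.

(* jac c d u i a = d y^a / d x^i, with x the coordinates of c, y those of d. *)
Definition jac (R : realType) (n : nat) (M : charted R n) (c d : atlas M)
    (u : 'rV[R]_n) : 'M[R]_n :=
  \matrix_(i, a) partial i (fun v => trans c d v 0 a) u.

Definition is_tensor02 (R : realType) (n : nat) (M : charted R n)
    (S : tensor02 M) : Prop :=
  (forall (c : atlas M) (i j : 'I_n), smooth_on (img c) (fun u => S c u i j)) /\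
  (forall (c d : atlas M) (p : M), dom c p -> dom d p ->
     S c (chart c p) =
     jac c d (chart c p) *m S d (chart d p) *m (jac c d (chart c p))^T).

Definition is_vfield (R : realType) (n : nat) (M : charted R n)
    (X : vfield M) : Prop :=
  (forall (c : atlas M) (i : 'I_n), smooth_on (img c) (fun u => X c u 0 i)) /\
  (forall (c d : atlas M) (p : M), dom c p -> dom d p ->
     X d (chart d p) = X c (chart c p) *m jac c d (chart c p)).

(* The index of g is then locally constant; it is not required to be the same on
   different connected components. *)
Definition pseudo_metric (R : realType) (n : nat) (M : charted R n)
    (g : tensor02 M) : Prop :=
  is_tensor02 g /\
  (forall (c : atlas M) (u : 'rV[R]_n), img c u ->
     (g c u)^T = g c u /\ g c u \in unitmx).

Definition tscale (R : realType) (n : nat) (M : charted R n) (F : M -> R)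
    (S : tensor02 M) : tensor02 M :=
  fun c u => F (chart_inv c u) *: S c u.

Definition otimes (R : realType) (n : nat) (M : charted R n)
    (a b : oneform M) : tensor02 M :=
  fun c u => (a c u)^T *m b c u.

Definition dif (R : realType) (n : nat) (M : charted R n) (F : M -> R) :
  oneform M := fun c u => \row_i partial i (F \o chart_inv c) u.

Definition vapply (R : realType) (n : nat) (M : charted R n) (X : vfield M)
    (F : M -> R) (p : M) : R :=
  let c := chart_at p in let u := chart c p in
  (X c u *m (dif F c u)^T) 0 0.

Definition Lie (R : realType) (n : nat) (M : charted R n) (X : vfield M)
    (S : tensor02 M) : tensor02 M :=
  fun c u => \matrix_(i, j) \sum_k
    (X c u 0 k * partial k (fun v => S c v i j) u
     + S c u k j * partial i (fun v => X c v 0 k) u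
     + S c u i k * partial j (fun v => X c v 0 k) u).

Definition trace (R : realType) (n : nat) (M : charted R n)
    (g S : tensor02 M) (p : M) : R :=
  let c := chart_at p in let u := chart c p in
  \tr (invmx (g c u) *m S c u).

Definition inner (R : realType) (n : nat) (M : charted R n) (g : tensor02 M)
    (X Y : vfield M) (p : M) : R :=
  let c := chart_at p in let u := chart c p in
  (X c u *m g c u *m (Y c u)^T) 0 0.

Definition grad (R : realType) (n : nat) (M : charted R n) (g : tensor02 M)
    (F : M -> R) : vfield M :=
  fun c u => dif F c u *m invmx (g c u).

(* christoffel g c k i j = Gamma^k_ij of the Levi-Civita connection. *)
Definition christoffel (R : realType) (n : nat) (M : charted R n)
    (g : tensor02 M) (c : atlas M) (k i j : 'I_n) (u : 'rV[R]_n) : R :=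
  2^-1 * \sum_l invmx (g c u) k l *
    (partial i (fun v => g c v j l) u + partial j (fun v => g c v i l) u
     - partial l (fun v => g c v i j) u).

(* riemann g c l k i j u = R^l_kij, where R(d_i, d_j) d_k = R^l_kij d_l and
   R(X, Y) = nabla_X nabla_Y - nabla_Y nabla_X - nabla_[X, Y]. *)
Definition riemann (R : realType) (n : nat) (M : charted R n)
    (g : tensor02 M) (c : atlas M) (l k i j : 'I_n) (u : 'rV[R]_n) : R :=
  partial i (christoffel g c l j k) u - partial j (christoffel g c l i k) u
  + \sum_m (christoffel g c l i m u * christoffel g c m j k u
            - christoffel g c l j m u * christoffel g c m i k u).

(* Ric(Y, W) = trace of X |-> R(X, Y) W; it is positive on round spheres. *)
Definition Ric (R : realType) (n : nat) (M : charted R n) (g : tensor02 M) :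
  tensor02 M := fun c u => \matrix_(j, k) \sum_i riemann g c i k i j u.

Definition scal (R : realType) (n : nat) (M : charted R n) (g : tensor02 M) :
  M -> R := trace g (Ric g).

Definition Hess (R : realType) (n : nat) (M : charted R n) (g : tensor02 M)
    (F : M -> R) : tensor02 M :=
  fun c u => \matrix_(i, j)
    (partial i (partial j (F \o chart_inv c)) u
     - \sum_k christoffel g c k i j u * partial k (F \o chart_inv c) u).

Definition Lap (R : realType) (n : nat) (M : charted R n) (g : tensor02 M)
    (F : M -> R) : M -> R := trace g (Hess g F).

Definition tracefree (R : realType) (n : nat) (M : charted R n)
    (g S : tensor02 M) : tensor02 M :=
  fun c u => S c u - tscale (fun p => n%:R^-1 * trace g S p) g c u.

(* Meant for g with [pseudo_metric g] and X with [is_vfield X]. *)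
Definition almost_RB_soliton (R : realType) (n : nat) (M : charted R n)
    (g : tensor02 M) (X : vfield M) (lam : M -> R) (rho : R) : Prop :=
  smooth_fun lam /\
  field_eq (fun c u => Ric g c u + 2^-1 *: Lie X g c u)
           (tscale (fun p => lam p + rho * scal g p) g).

Definition pull1 (R : realType) (n1 n2 : nat)
    (M1 : charted R n1) (M2 : charted R n2) (S : tensor02 M1) :
  tensor02 (mprod M1 M2) :=
  fun c u => block_mx (S c.1 (lsubmx u)) 0 0 0.
Definition pull2 (R : realType) (n1 n2 : nat)
    (M1 : charted R n1) (M2 : charted R n2) (S : tensor02 M2) :
  tensor02 (mprod M1 M2) :=
  fun c u => block_mx 0 0 0 (S c.2 (rsubmx u)).

Definition lift1 (R : realType) (n1 n2 : nat)
    (M1 : charted R n1) (M2 : charted R n2) (X : vfield M1) :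
  vfield (mprod M1 M2) := fun c u => row_mx (X c.1 (lsubmx u)) 0.
Definition lift2 (R : realType) (n1 n2 : nat)
    (M1 : charted R n1) (M2 : charted R n2) (X : vfield M2) :
  vfield (mprod M1 M2) := fun c u => row_mx 0 (X c.2 (rsubmx u)).

Arguments pull1 {R n1 n2 M1} M2 S.
Arguments pull2 {R n1 n2} M1 {M2} S.
Arguments lift1 {R n1 n2 M1} M2 X.
Arguments lift2 {R n1 n2} M1 {M2} X.

Definition twisted_metric (R : realType) (n1 n2 : nat)
    (M1 : charted R n1) (M2 : charted R n2) (g1 : tensor02 M1)
    (g2 : tensor02 M2) (f : mprod M1 M2 -> R) : tensor02 (mprod M1 M2) :=
  fun c u => pull1 M2 g1 c u + tscale (fun p => f p ^+ 2) (pull2 M1 g2) c u.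

Definition lyra_metric (R : realType) (n1 n2 : nat)
    (M1 : charted R n1) (M2 : charted R n2) (g1 : tensor02 M1)
    (g2 : tensor02 M2) (f phi : mprod M1 M2 -> R) : tensor02 (mprod M1 M2) :=
  tscale (fun p => phi p ^+ 2) (twisted_metric g1 g2 f).

Definition projectable (R : realType) (n1 n2 : nat)
    (M1 : charted R n1) (M2 : charted R n2) (Z : vfield (mprod M1 M2))
    (Z1 : vfield M1) (Z2 : vfield M2) : Prop :=
  field_eq Z (fun c u => lift1 M2 Z1 c u + lift2 M1 Z2 c u).

(* Main.v *)
(* With x fixed and k = k1 - k1 x, the metric g_L is the doubly warped product
   e^(2 sigma2) g1 + e^(2 k) h, where h is the metric of the slice over x.  The
   fiber block of its Ricci tensor is
     Ric_h - n1 (Hess_h sigma2 + d sigma2 (x) d sigma2) - e^(-2 sigma2) a1 h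
   over x, and Hess_h sigma2 + d sigma2 (x) d sigma2 = C2 + c2 g2 by the conformal
   change of the Hessian.  The fiber block of the soliton equation therefore says
   that Ric_h + 1/2 L_(Z2) h equals n1 C2 plus a multiple of h, whence the
   equivalence and the formula.

   Scalar curvature is evaluated in the preferred charts only.  Its chart
   invariance would need second derivatives of the transition maps; instead, the
   smoothness of rho R_h is deduced from that of lambda, by comparing the traces of
   the two soliton equations in the preferred charts.  Only first-order quantities
   are moved between charts. *)
Require Import Defs.
From HB Require Import structures.
From mathcomp Require Import all_boot all_order all_algebra.
From mathcomp Require Import all_classical all_reals all_analysis.
From mathcomp Require Import ring.
Set Implicit Arguments.
Unset Strict Implicit.
Unset Printing Implicit Defensive.
Import Order.TTheory GRing.Theory Num.Theory.
Import numFieldNormedType.Exports.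
Local Open Scope classical_set_scope.
Local Open Scope ring_scope.

(** The shift k1 - k1(x) vanishes at x, so e^(2k) is 1 on the slice and the fiber factor h needs no
    rescaling there, while the derivatives of k1 are unchanged. The base is read in [chart_at x],
    the chart in which the Laplacian at x is evaluated by definition.

    The coefficient n1 counts base directions: each contributes the same Hessian term of sigma2 to
    the fiber Ricci tensor. The quantity a1 equals e^(-n2 k1) Delta_1(e^(n2 k1)) / n2.

    The obstacle is the smoothness required of lambda_(2,x). The factor mu = lambda_(2,x) + rho R_h
    relates tensors with smooth components, hence is smooth. Solving its formula for Phi = lambda +
    rho R^L shows that Phi is smooth along the slice, and so is rho R^L = Phi - lambda. The
    divergence of Z2 for h occurs with the same coefficient in both traced equations, hence cancels
    in R_h - R^L, which becomes an expression in mu, Phi and first derivatives. Thus rho R_h = rho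
    (R_h - R^L) + rho R^L is smooth for every rho, with no division by rho or by 1 - n rho. *)

(** * Partial derivatives and differentiability of germs *)

Section PartialCalculus.
Variables (R : realType) (n : nat).
Implicit Types (U : set 'rV[R]_n) (F G : 'rV[R]_n -> R) (u : 'rV[R]_n).

Lemma near_on U u F G : open U -> U u -> {in U, F =1 G} ->
  \forall v \near u, F v = G v.
Proof.
move=> oU Uu FG; have := open_nbhs_nbhs (conj oU Uu).
by apply: filterS => v Uv; apply: FG; rewrite inE.
Qed.

Lemma eq_partial_on U u F G i : open U -> U u -> {in U, F =1 G} ->
  partial i F u = partial i G u.
Proof. by move=> oU Uu FG; apply/near_eq_derive/(near_on oU). Qed.

(** The first-order expansion of [f] at [x] is also one for [g], because the remainders agree near
    0; uniqueness of the differential does the rest. *)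
Lemma near_differentiable (V W : normedModType R) (f g : V -> W) x :
  (\near x, f x = g x) -> differentiable f x -> differentiable g x.
Proof.
move=> fg df; have dfc := diff_continuous df.
suff e : g \o shift x = cst (g x) + 'd f x +o_ 0 id.
  by apply/diff_locallyP; rewrite (diff_unique dfc e).
have fg0 : \forall h \near 0, f (h + x) = g (h + x).
  by move: fg; rewrite (near_shift 0 x); apply: filterS => h /=; rewrite subr0.
rewrite -(nbhs_singleton fg); apply/eqaddoP => _/posnumP[eps].
have /diff_locally/eqaddoP/(_ eps%:num) := df.
move=> /(_ (gt0 eps)); apply: filterS2 fg0 => h /= e.
by rewrite -[(f \o _ - _) h]/(f (h + x) - _) e.
Qed.

Lemma differentiable_cst_fun u (a : R) : differentiable (fun _ => a) u.
Proof. exact: differentiable_cst. Qed.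

Lemma partial_cst i (a : R) u : partial i (fun _ => a) u = 0.
Proof. exact: derive_cst. Qed.

Lemma partialD i F G u : differentiable F u -> differentiable G u ->
  partial i (fun v => F v + G v) u = partial i F u + partial i G u.
Proof. by move=> dF dG; apply: deriveD; exact: diff_derivable. Qed.

Lemma partialM i F G u : differentiable F u -> differentiable G u ->
  partial i (fun v => F v * G v) u = F u * partial i G u + G u * partial i F u.
Proof. by move=> dF dG; apply: deriveM; exact: diff_derivable. Qed.

Lemma partialZ i (a : R) F u : differentiable F u ->
  partial i (fun v => a * F v) u = a * partial i F u.
Proof. by move=> dF; apply: deriveZ; exact: diff_derivable. Qed.

Lemma partial_sum m i (F : 'I_m -> 'rV[R]_n -> R) u :
  (forall j, differentiable (F j) u) ->
  partial i (fun v => \sum_j F j v) u = \sum_j partial i (F j) u.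
Proof.
move=> dF; rewrite -derive_sum => [|j]; last exact: diff_derivable.
by congr derive; apply/funext => v; rewrite fct_sumE.
Qed.

Lemma differentiable_expR F u : differentiable F u ->
  differentiable (fun v => expR (F v)) u.
Proof.
move=> dF; apply: (@differentiable_comp _ _ _ _ F expR) => //.
exact/derivable1_diffP/derivable_expR.
Qed.

Lemma partial_expR i F u : differentiable F u ->
  partial i (fun v => expR (F v)) u = expR (F u) * partial i F u.
Proof.
move=> dF; have dE : differentiable (expR : R -> R) (F u).
  exact/derivable1_diffP/derivable_expR.
rewrite /partial deriveE; last exact: (@differentiable_comp _ _ _ _ F expR).
rewrite (@diff_comp _ _ _ _ F expR) //= diff1E //= derive1E.
rewrite (@derive_val _ _ _ _ _ _ _ (is_derive_expR (F u))).
by rewrite deriveE // mulrC.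
Qed.

Lemma partial_warp i F u : differentiable F u ->
  partial i (fun v => expR (2 * F v)) u = expR (2 * F u) * (2 * partial i F u).
Proof.
by move=> dF; rewrite partial_expR ?partialZ //; exact: differentiableZ.
Qed.

Lemma differentiable_warp F u : differentiable F u ->
  differentiable (fun v => expR (2 * F v)) u.
Proof. by move=> dF; apply: differentiable_expR; exact: differentiableZ. Qed.

Lemma partialV i F u : F u != 0 -> differentiable F u ->
  partial i (fun v => (F v)^-1) u = - (F u) ^- 2 * partial i F u.
Proof. by move=> F0 dF; apply: deriveV => //; exact: diff_derivable. Qed.

Lemma differentiable_rowP (m : nat) (T : 'rV[R]_n -> 'rV[R]_m) u :
  (forall a, differentiable (fun v => T v 0 a) u) -> differentiable T u.
Proof.
move=> dT.
rewrite (_ : T = \sum_a (fun v => T v 0 a *: (delta_mx 0 a : 'rV[R]_m))).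
  by apply: differentiable_sum => a; apply: differentiableZl.
by apply/funext => v; rewrite fct_sumE [LHS]row_sum_delta.
Qed.

Lemma partial_comp (m : nat) (T : 'rV[R]_n -> 'rV[R]_m) (H : 'rV[R]_m -> R) u i :
  (forall a, differentiable (fun v => T v 0 a) u) -> differentiable H (T u) ->
  partial i (fun v => H (T v)) u
  = \sum_a partial i (fun v => T v 0 a) u * partial a H (T u).
Proof.
move=> dT dH; have dTu := differentiable_rowP dT.
rewrite /partial deriveE; last exact: differentiable_comp.
rewrite (@diff_comp _ _ _ _ T H) //=.
have -> : 'd T u (delta_mx 0 i) = \row_a partial i (fun v => T v 0 a) u.
  rewrite -deriveE // derive_mx; last exact: diff_derivable.
  by apply/rowP => a; rewrite !mxE.
rewrite [X in 'd H _ X]row_sum_delta linear_sum; apply: eq_bigr => a _.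
by rewrite linearZ /= mxE (@deriveE _ _ _ H).
Qed.

End PartialCalculus.

(** * Partial derivatives along the factors of a product *)

Section ProductCoordinates.
Variables (R : realType) (n1 n2 : nat).
Implicit Types (H : 'rV[R]_n1 -> 'rV[R]_n2 -> R) (u : 'rV[R]_(n1 + n2)).

(** The direction has zero right block, so the two difference quotients are the same function of the
    increment; the limits agree for every [H]. *)
Lemma partial_lshift i H u :
  partial (lshift n2 i) (fun v => H (lsubmx v) (rsubmx v)) u
  = partial i (fun w => H w (rsubmx u)) (lsubmx u).
Proof.
rewrite /partial /derive; apply: (congr1 (fun f => lim (f @ 0^'))); apply/funext => h /=.
have -> : delta_mx 0 (lshift n2 i) = row_mx (delta_mx 0 i) 0 :> 'rV[R]_(n1 + n2).
  by apply/rowP => k; case: (split_ordP k) => j ->;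
    rewrite ?row_mxEl ?row_mxEr !mxE ?eq_shift.
rewrite !linearD !linearZ /= row_mxKl row_mxKr.
by rewrite scaler0 add0r.
Qed.

Lemma partial_rshift i H u :
  partial (rshift n1 i) (fun v => H (lsubmx v) (rsubmx v)) u
  = partial i (H (lsubmx u)) (rsubmx u).
Proof.
rewrite /partial /derive; apply: (congr1 (fun f => lim (f @ 0^'))); apply/funext => h /=.
have -> : delta_mx 0 (rshift n1 i) = row_mx 0 (delta_mx 0 i) :> 'rV[R]_(n1 + n2).
  by apply/rowP => k; case: (split_ordP k) => j ->;
    rewrite ?row_mxEl ?row_mxEr !mxE ?eq_shift.
rewrite !linearD !linearZ /= row_mxKl row_mxKr.
by rewrite scaler0 add0r.
Qed.

End ProductCoordinates.

(** * Closure properties of smooth functions on an open set *)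

Section SmoothOn.
Variables (R : realType) (n : nat) (U : set 'rV[R]_n).
Hypothesis oU : open U.
Implicit Types (F G : 'rV[R]_n -> R).

(** A coinduction principle: by induction on the list of indices, every iterated partial derivative
    agrees on U with a member of [P]. Agreement is asked on U only, since rules such as the one for
    inverses hold only there. *)
Lemma smooth_on_coind (P : ('rV[R]_n -> R) -> Prop) :
    (forall F u, P F -> U u -> differentiable F u) ->
    (forall F i, P F -> exists2 G, P G & {in U, partial i F =1 G}) ->
  forall F, P F -> smooth_on U F.
Proof.
move=> dP stP F PF s u Uu.
have [G PG FG] : exists2 G, P G & {in U, foldr (@partial R n) F s =1 G}.
  elim: s => [|i s [G PG FG]] /=; first by exists F.
  have [G' PG' GG'] := stP G i PG; exists G' => // v Uv.
  by rewrite -GG' //; apply: (eq_partial_on i oU) => //; rewrite inE in Uv.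
apply: near_differentiable (dP G u PG Uu).
by apply: (near_on oU Uu) => v Uv; rewrite FG.
Qed.

Lemma smooth_on_differentiable F u : smooth_on U F -> U u -> differentiable F u.
Proof. by move=> sF; apply: (sF [::]). Qed.

Lemma smooth_on_partial i F : smooth_on U F -> smooth_on U (partial i F).
Proof. by move=> sF s u Uu; have := sF (rcons s i) u Uu; rewrite foldr_rcons. Qed.

Lemma eq_smooth_on F G : {in U, F =1 G} -> smooth_on U F -> smooth_on U G.
Proof.
move=> FG sF.
apply: (@smooth_on_coind (fun G => exists2 F, smooth_on U F & {in U, F =1 G})).
- move=> {FG sF}{}G u [{}F sF FG] Uu.
  exact: near_differentiable (near_on oU Uu FG) (smooth_on_differentiable sF Uu).
- move=> {FG sF}{}G i [{}F sF FG]; exists (partial i F).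
    by exists (partial i F) => //; apply: smooth_on_partial.
  by move=> v Uv; apply/esym/(eq_partial_on i oU) => //; rewrite inE in Uv.
by exists F.
Qed.

(** The derivative of a product is a sum of products, so closure under the single operations cannot
    be proved separately. This class is closed under all of them at once and, up to equality on U,
    under partial derivatives. *)
Inductive smooth_gen : ('rV[R]_n -> R) -> Prop :=
| SGbase F : smooth_on U F -> smooth_gen F
| SGcst a : smooth_gen (fun _ => a)
| SGadd F G : smooth_gen F -> smooth_gen G -> smooth_gen (fun u => F u + G u)
| SGmul F G : smooth_gen F -> smooth_gen G -> smooth_gen (fun u => F u * G u)
| SGinv F : smooth_gen F -> (forall u, U u -> F u != 0) ->
    smooth_gen (fun u => (F u)^-1)
| SGexp F : smooth_gen F -> smooth_gen (fun u => expR (F u)).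

Lemma smooth_gen_on F : smooth_gen F -> smooth_on U F.
Proof.
have dP G u : smooth_gen G -> U u -> differentiable G u.
  move=> sG Uu.
  elim: sG => {G} [G sG|a|G H _ dG _ dH|G H _ dG _ dH|G _ dG G0|G _ dG].
  - exact: smooth_on_differentiable sG Uu.
  - exact: differentiable_cst_fun.
  - exact: differentiableD.
  - exact: differentiableM.
  - by apply: differentiableV => //; apply: G0.
  - exact: differentiable_expR.
apply: smooth_on_coind => // G i.
elim=> {F G} [G sG|a|G H sG [G' sG' GG'] sH [H' sH' HH']
  |G H sG [G' sG' GG'] sH [H' sH' HH']|G sG [G' sG' GG'] G0|G sG [G' sG' GG']].
- by exists (partial i G) => //; apply/SGbase/smooth_on_partial.
- by exists (fun=> 0); [exact: SGcst | move=> u _; exact: partial_cst].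
- exists (fun u => G' u + H' u); first exact: SGadd.
  move=> u Uu; rewrite -GG' // -HH' //; move: Uu; rewrite inE => Uu.
  by apply: partialD; apply: dP.
- exists (fun u => G u * H' u + H u * G' u).
    by apply: SGadd; apply: SGmul.
  move=> u Uu; rewrite -GG' // -HH' //; move: Uu; rewrite inE => Uu.
  by apply: partialM; apply: dP.
(* The derivative -G'/G^2, written with the generators only. *)
- exists (fun u => (-1 * ((G u)^-1 * (G u)^-1)) * G' u).
    apply: SGmul sG'; apply: SGmul (SGcst _) _.
    by apply: SGmul; apply: SGinv.
  move=> u Uu; rewrite -GG' //; move: Uu; rewrite inE => Uu.
  rewrite partialV ?G0 //; last exact: dP.
  by rewrite mulN1r -expr2 exprVn.
- exists (fun u => expR (G u) * G' u).
    by apply: SGmul => //; apply: SGexp.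
  move=> u Uu; rewrite -GG' //; move: Uu; rewrite inE => Uu.
  by apply: partial_expR; apply: dP.
Qed.

Lemma smooth_on_cst (a : R) : smooth_on U (fun _ => a).
Proof. exact/smooth_gen_on/SGcst. Qed.

Lemma smooth_onD F G : smooth_on U F -> smooth_on U G ->
  smooth_on U (fun u => F u + G u).
Proof. by move=> sF sG; apply/smooth_gen_on/SGadd; apply: SGbase. Qed.

Lemma smooth_onM F G : smooth_on U F -> smooth_on U G ->
  smooth_on U (fun u => F u * G u).
Proof. by move=> sF sG; apply/smooth_gen_on/SGmul; apply: SGbase. Qed.

Lemma smooth_onN F : smooth_on U F -> smooth_on U (fun u => - F u).
Proof.
move=> sF; apply: (eq_smooth_on (F := fun u => -1 * F u)).
  by move=> u _; rewrite mulN1r.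
by apply: smooth_onM => //; apply: smooth_on_cst.
Qed.

Lemma smooth_onB F G : smooth_on U F -> smooth_on U G ->
  smooth_on U (fun u => F u - G u).
Proof. by move=> sF sG; apply/smooth_onD/smooth_onN. Qed.

Lemma smooth_onV F : smooth_on U F -> (forall u, U u -> F u != 0) ->
  smooth_on U (fun u => (F u)^-1).
Proof. by move=> sF F0; apply/smooth_gen_on/SGinv => //; apply: SGbase. Qed.

Lemma smooth_on_expR F : smooth_on U F -> smooth_on U (fun u => expR (F u)).
Proof. by move=> sF; apply/smooth_gen_on/SGexp/SGbase. Qed.

Lemma smooth_on_sum (I : Type) (r : seq I) (P : pred I) (F : I -> 'rV[R]_n -> R) :
  (forall i, P i -> smooth_on U (F i)) ->
  smooth_on U (fun u => \sum_(i <- r | P i) F i u).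
Proof.
move=> sF; rewrite (_ : (fun u => _) = \sum_(i <- r | P i) F i).
  apply: big_ind => //; first exact: smooth_on_cst.
  by move=> G H; exact: smooth_onD.
by apply/funext => u; rewrite fct_sumE.
Qed.

Lemma smooth_on_prod (I : Type) (r : seq I) (P : pred I) (F : I -> 'rV[R]_n -> R) :
  (forall i, P i -> smooth_on U (F i)) ->
  smooth_on U (fun u => \prod_(i <- r | P i) F i u).
Proof.
move=> sF; rewrite (_ : (fun u => _) = \prod_(i <- r | P i) F i).
  apply: big_ind => //; first exact: smooth_on_cst.
  by move=> G H; exact: smooth_onM.
by apply/funext => u; rewrite fct_prodE.
Qed.

End SmoothOn.

(** * Smooth families of matrices *)

Section SmoothMatrices.
Variables (R : realType) (n : nat) (U : set 'rV[R]_n).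
Hypothesis oU : open U.

Definition smooth_mx (m p : nat) (A : 'rV[R]_n -> 'M[R]_(m, p)) : Prop :=
  forall i j, smooth_on U (fun u => A u i j).

Lemma smooth_mxM (m p q : nat) (A : 'rV[R]_n -> 'M[R]_(m, p))
    (B : 'rV[R]_n -> 'M[R]_(p, q)) :
  smooth_mx A -> smooth_mx B -> smooth_mx (fun u => A u *m B u).
Proof.
move=> sA sB i j; under [X in smooth_on _ X]funext do rewrite mxE.
by apply: smooth_on_sum => // k _; apply: smooth_onM => //.
Qed.

Lemma smooth_mx_tr (m p : nat) (A : 'rV[R]_n -> 'M[R]_(m, p)) :
  smooth_mx A -> smooth_mx (fun u => (A u)^T).
Proof.
move=> sA i j; under [X in smooth_on _ X]funext do rewrite mxE.
exact: sA.
Qed.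

Lemma smooth_on_det (m : nat) (A : 'rV[R]_n -> 'M[R]_m) :
  smooth_mx A -> smooth_on U (fun u => \det (A u)).
Proof.
move=> sA; apply: smooth_on_sum => // s _; apply: smooth_onM => //.
  exact: smooth_on_cst.
by apply: smooth_on_prod => // i _.
Qed.

(** Cramer's rule: each entry is a cofactor divided by the determinant, which does not vanish on
    U. *)
Lemma smooth_mx_inv (m : nat) (A : 'rV[R]_n -> 'M[R]_m) :
  smooth_mx A -> (forall u, U u -> A u \in unitmx) ->
  smooth_mx (fun u => invmx (A u)).
Proof.
move=> sA uA i j.
apply: (eq_smooth_on oU (F := fun u => (\det (A u))^-1 * \adj (A u) i j)).
  by move=> u; rewrite inE => Uu; rewrite /invmx uA // [RHS]mxE.
apply: smooth_onM => //.
  apply: smooth_onV => //; first exact: smooth_on_det.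
  by move=> u Uu; have := uA u Uu; rewrite unitmxE unitfE.
under [X in smooth_on _ X]funext do rewrite mxE.
apply: smooth_onM => //; first exact: smooth_on_cst.
apply: smooth_on_det => k l.
under [X in smooth_on _ X]funext do rewrite !mxE.
exact: sA.
Qed.

Lemma smooth_on_mxtrace (m : nat) (A : 'rV[R]_n -> 'M[R]_m) :
  smooth_mx A -> smooth_on U (fun u => \tr (A u)).
Proof. by move=> sA; apply: smooth_on_sum => // i _. Qed.

End SmoothMatrices.

(** * Restriction of smooth functions to a slice *)

Section SmoothSlice.
Variables (R : realType) (n1 n2 : nat).

(** Restrictions of smooth functions form a class stable under partial derivatives: a fiber
    derivative of a restriction is the restriction of that derivative. *)
Lemma smooth_on_slice (W : set 'rV[R]_(n1 + n2)) (V : set 'rV[R]_n2)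
    (F : 'rV[R]_(n1 + n2) -> R) (u0 : 'rV[R]_n1) :
  open V -> (forall v, V v -> W (row_mx u0 v)) ->
  smooth_on W F -> smooth_on V (fun v => F (row_mx u0 v)).
Proof.
move=> oV VW sF.
apply: (smooth_on_coind oV (P := fun f =>
  exists2 F, smooth_on W F & f = fun v => F (row_mx u0 v))); last by exists F.
- move=> {sF F} _ v [F sF ->] Vv.
  apply: (@differentiable_comp _ _ _ _ (row_mx u0) F).
    apply: differentiable_rowP => k; case: (split_ordP k) => l ->.
      under [X in differentiable X _]funext do rewrite row_mxEl.
      exact: differentiable_cst_fun.
    under [X in differentiable X _]funext do rewrite row_mxEr.
    exact: differentiable_coord.
  exact: smooth_on_differentiable sF (VW _ Vv).
- move=> {sF F} _ i [F sF ->].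
  exists (fun v => partial (rshift n1 i) F (row_mx u0 v)).
    by exists (partial (rshift n1 i) F) => //; apply: smooth_on_partial.
  move=> v _; have := partial_rshift i (fun w v => F (row_mx w v)) (row_mx u0 v).
  rewrite row_mxKl row_mxKr => <-.
  by congr (partial _ _ _); apply/funext => w; rewrite hsubmxK.
Qed.

End SmoothSlice.

(** * Coordinate expressions of the geometric objects *)

Section CoordinateGeometry.
Variables (R : realType) (n : nat).
Implicit Types (g : 'rV[R]_n -> 'M[R]_n) (F : 'rV[R]_n -> R)
  (X : 'rV[R]_n -> 'rV[R]_n) (u : 'rV[R]_n).

(* Coordinate expressions of the tensors of Defs: [Ric g c] and [ric (g c)] are
   convertible, and likewise for [christoffel], [dif], [Hess] and [Lie]. *)
Definition chr g (k i j : 'I_n) u : R :=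
  2^-1 * \sum_l invmx (g u) k l *
    (partial i (fun v => g v j l) u + partial j (fun v => g v i l) u
     - partial l (fun v => g v i j) u).

Definition ric g u : 'M[R]_n := \matrix_(j, k) \sum_i
  (partial i (chr g i j k) u - partial j (chr g i i k) u
   + \sum_m (chr g i i m u * chr g m j k u - chr g i j m u * chr g m i k u)).

Definition dd F u : 'rV[R]_n := \row_i partial i F u.

Definition hess g F u : 'M[R]_n := \matrix_(i, j)
  (partial i (partial j F) u - \sum_k chr g k i j u * partial k F u).

Definition lie X g u : 'M[R]_n := \matrix_(i, j) \sum_k
  (X u 0 k * partial k (fun v => g v i j) u
   + g u k j * partial i (fun v => X v 0 k) u
   + g u i k * partial j (fun v => X v 0 k) u).

(** The inner product of the gradients of F and H, written with their differentials. *)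
Definition dprod g (F H : 'rV[R]_n -> R) u : R :=
  (dd F u *m invmx (g u) *m (dd H u)^T) 0 0.

Definition grad_comp g F (i : 'I_n) u : R :=
  \sum_l invmx (g u) i l * partial l F u.

Lemma dprodE g F H u : dprod g F H u =
  \sum_i partial i H u * \sum_l partial l F u * invmx (g u) l i.
Proof.
rewrite /dprod mxE; apply: eq_bigr => i _; rewrite !mxE mulrC; congr (_ * _).
by apply: eq_bigr => l _; rewrite mxE.
Qed.

End CoordinateGeometry.

(** * Identities of the Levi-Civita connection *)

Section MetricOnOpenSet.
Variables (R : realType) (n : nat) (U : set 'rV[R]_n) (g : 'rV[R]_n -> 'M[R]_n).
Hypotheses (oU : open U) (g_smooth : smooth_mx U g).
Hypotheses (g_sym : forall u, U u -> (g u)^T = g u).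
Hypotheses (g_unit : forall u, U u -> g u \in unitmx).

Let inv_smooth : smooth_mx U (fun u => invmx (g u)).
Proof. exact: smooth_mx_inv. Qed.

Lemma metric_symE u i j : U u -> g u i j = g u j i.
Proof. by move=> Uu; rewrite -[in LHS]g_sym // mxE. Qed.

Lemma invmx_symE u i j : U u -> invmx (g u) i j = invmx (g u) j i.
Proof. by move=> Uu; rewrite -[in LHS](g_sym Uu) -trmx_inv mxE. Qed.

Lemma partial_metric_sym k i j u : U u ->
  partial k (fun v => g v i j) u = partial k (fun v => g v j i) u.
Proof.
move=> Uu; apply: (eq_partial_on k oU) => // v; rewrite inE => Uv.
exact: metric_symE.
Qed.

Lemma chr_smooth k i j : smooth_on U (chr g k i j).
Proof.
apply: smooth_onM => //; first exact: smooth_on_cst.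
apply: smooth_on_sum => // l _; apply: smooth_onM => //.
by apply: smooth_onB => //; [apply: smooth_onD => //|]; apply: smooth_on_partial.
Qed.

Lemma grad_comp_smooth F i : smooth_on U F -> smooth_on U (grad_comp g F i).
Proof.
move=> sF; apply: smooth_on_sum => // l _; apply: smooth_onM => //.
exact: smooth_on_partial.
Qed.

(** Differentiate g g^-1 = 1. *)
Lemma partial_invmx i u : U u ->
  \matrix_(p, q) partial i (fun v => invmx (g v) p q) u
  = - (invmx (g u) *m (\matrix_(p, q) partial i (fun v => g v p q) u)
       *m invmx (g u)).
Proof.
move=> Uu; set Di := (X in X = _); set Dg := (X in _ *m X *m _).
have dg p q : differentiable (fun v => g v p q) u.
  exact: smooth_on_differentiable (g_smooth p q) Uu.
have di p q : differentiable (fun v => invmx (g v) p q) u.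
  exact: smooth_on_differentiable (inv_smooth p q) Uu.
have e : g u *m Di + Dg *m invmx (g u) = 0.
  apply/matrixP => p q; rewrite !mxE -big_split /=.
  transitivity (partial i (fun v => \sum_m g v p m * invmx (g v) m q) u).
    rewrite partial_sum => [|m]; last exact: differentiableM.
    by apply: eq_bigr => m _; rewrite partialM // !mxE [in RHS](mulrC (invmx _ _ _)).
  transitivity (partial i (fun _ => (1%:M : 'M[R]_n) p q) u); last exact: partial_cst.
  apply: (eq_partial_on i oU) => // v; rewrite inE => Uv.
  by rewrite -(mulmxV (g_unit Uv)) mxE.
have /(congr1 (mulmx (invmx (g u)))) := e.
rewrite mulmxDr mulmxA mulVmx ?g_unit // mul1mx mulmx0 mulmxA.
by move/eqP; rewrite addr_eq0 => /eqP.
Qed.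

(** Compatibility of the connection with g. Lowering the upper index gives Christoffel symbols of
    the first kind ([gC]), whose symmetrization is the derivative of the metric. *)
Lemma partial_metric i u : U u ->
  \matrix_(p, q) partial i (fun v => g v p q) u
  = g u *m (\matrix_(l, m) chr g l i m u)
    + (g u *m (\matrix_(l, m) chr g l i m u))^T.
Proof.
move=> Uu.
have gC p m : (g u *m (\matrix_(l, m) chr g l i m u)) p m =
    2^-1 * (partial i (fun v => g v m p) u + partial m (fun v => g v i p) u
     - partial p (fun v => g v i m) u).
  rewrite mxE /chr; under eq_bigr do rewrite mxE mulrCA mulr_sumr.
  rewrite -mulr_sumr exchange_big /=; congr (_ * _).
  under eq_bigr => l _ do under eq_bigr do rewrite mulrA.
  under eq_bigr => l _ do rewrite -mulr_suml.
  rewrite (bigD1 p) //= [X in _ + X]big1 ?addr0 => [|l /negPf lp].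
    by have := mulmxV (g_unit Uu) => /matrixP/(_ p p); rewrite !mxE eqxx => ->; rewrite mul1r.
  by have := mulmxV (g_unit Uu) => /matrixP/(_ p l); rewrite !mxE eq_sym lp => ->; rewrite mul0r.
apply/matrixP => p q; rewrite [LHS]mxE [RHS]mxE [in X in _ + X]mxE !gC.
by rewrite (partial_metric_sym i q p Uu); field.
Qed.

(** The parallelism of the inverse metric, contracted in one index. The contracted symbols on the
    left cancel one half of the derivative of the inverse. *)
Lemma trace_partial_invmx l u : U u ->
  \sum_i partial i (fun v => invmx (g v) i l) u
  + \sum_i \sum_j chr g i i j u * invmx (g u) j l
  = - \sum_i \sum_j invmx (g u) i j * chr g l j i u.
Proof.
move=> Uu.
have pinv i : partial i (fun v => invmx (g v) i l) u
    = - \sum_m (chr g i i m u * invmx (g u) m l + invmx (g u) i m * chr g l i m u).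
  have := partial_invmx i Uu => /matrixP/(_ i l); rewrite mxE => ->.
  rewrite partial_metric // mulmxDr mulmxDl mxE; congr (- _).
  rewrite trmx_mul g_sym // mulmxA mulVmx ?g_unit // mul1mx.
  rewrite -!mulmxA mulmxV ?g_unit // mulmx1 !mxE -big_split /=.
  by apply: eq_bigr => m _; rewrite !mxE.
under eq_bigr do rewrite pinv.
rewrite sumrN; under eq_bigr do rewrite big_split /=.
rewrite big_split /= opprD addrAC addNr add0r; congr (- _).
rewrite [RHS]exchange_big; apply: eq_bigr => i _; apply: eq_bigr => j _.
by rewrite (invmx_symE j i).
Qed.

(** The Ricci tensor of a warped metric produces the divergence of a gradient, whereas [Lap] is the
    trace of the Hessian; this lemma joins the two. *)
Lemma divergence_grad F u : smooth_on U F -> U u ->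
  \sum_i (partial i (grad_comp g F i) u
          + \sum_j chr g i i j u * grad_comp g F j u)
  = \tr (invmx (g u) *m hess g F u).
Proof.
move=> sF Uu; rewrite /mxtrace.
have dF i : differentiable (partial i F) u.
  exact: smooth_on_differentiable (smooth_on_partial i sF) Uu.
have pgrad i : partial i (grad_comp g F i) u = \sum_l (invmx (g u) i l * partial i (partial l F) u
     + partial l F u * partial i (fun v => invmx (g v) i l) u).
  rewrite /grad_comp partial_sum => [|l].
    apply: eq_bigr => l _; rewrite partialM //.
    exact: smooth_on_differentiable (inv_smooth i l) Uu.
  by apply: differentiableM => //; apply: smooth_on_differentiable (inv_smooth i l) Uu.
under eq_bigr => i _ do rewrite pgrad big_split /= -addrA.
rewrite big_split /=.
transitivity (\sum_i \sum_l invmx (g u) i l * partial i (partial l F) u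
   + \sum_l partial l F u * (\sum_i partial i (fun v => invmx (g v) i l) u
       + \sum_i \sum_j chr g i i j u * invmx (g u) j l)).
  congr (_ + _); rewrite big_split /=.
  under [in RHS]eq_bigr do rewrite mulrDr.
  rewrite big_split /=; congr (_ + _).
    by rewrite exchange_big /=; apply: eq_bigr => l _; rewrite mulr_sumr.
  under [RHS]eq_bigr do rewrite mulr_sumr.
  rewrite [RHS]exchange_big; apply: eq_bigr => i _.
  under [RHS]eq_bigr do rewrite mulr_sumr.
  rewrite [RHS]exchange_big; apply: eq_bigr => j _.
  rewrite /grad_comp mulr_sumr; apply: eq_bigr => l _; ring.
under [X in _ + X]eq_bigr do rewrite trace_partial_invmx //.
transitivity (\sum_i \sum_l invmx (g u) i l * hess g F u l i); last first.
  by apply: eq_bigr => i _; rewrite mxE.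
transitivity (\sum_i \sum_l (invmx (g u) i l * partial l (partial i F) u
   - invmx (g u) i l * \sum_k chr g k l i u * partial k F u)); last first.
  by apply: eq_bigr => i _; apply: eq_bigr => l _; rewrite mxE mulrBr.
(* Relabelling the double sum and the symmetry of the inverse metric take the place of the
   commutation of second derivatives. *)
have -> : \sum_i \sum_l invmx (g u) i l * partial i (partial l F) u
    = \sum_i \sum_l invmx (g u) i l * partial l (partial i F) u.
  rewrite [LHS]exchange_big; apply: eq_bigr => i _; apply: eq_bigr => l _.
  by rewrite invmx_symE.
have -> : \sum_l partial l F u * - (\sum_i \sum_j invmx (g u) i j * chr g l j i u)
    = - \sum_i \sum_l invmx (g u) i l * \sum_k chr g k l i u * partial k F u.
  under eq_bigr do rewrite mulrN.
  rewrite sumrN; congr (- _).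
  under eq_bigr do rewrite mulr_sumr.
  rewrite [LHS]exchange_big; apply: eq_bigr => i _.
  under eq_bigr do rewrite mulr_sumr.
  rewrite [LHS]exchange_big; apply: eq_bigr => j _.
  by rewrite mulr_sumr; apply: eq_bigr => l _; ring.
rewrite -sumrN -big_split; apply: eq_bigr => i _.
by rewrite /= -sumrN -big_split.
Qed.

End MetricOnOpenSet.

(** * Conformal change of the connection and the Hessian *)

Section Conformal.
Variables (R : realType) (n : nat) (U : set 'rV[R]_n) (g : 'rV[R]_n -> 'M[R]_n).
Hypotheses (oU : open U) (g_smooth : smooth_mx U g).
Hypotheses (g_sym : forall u, U u -> (g u)^T = g u).
Hypotheses (g_unit : forall u, U u -> g u \in unitmx).

Lemma sum_delta (k : 'I_n) (f : 'I_n -> R) : \sum_l (l == k)%:R * f l = f k.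
Proof.
by rewrite (bigD1 k) //= eqxx mul1r big1 ?addr0 // => l /negPf ->; rewrite mul0r.
Qed.

Lemma invmx_mul_metric k j u : U u ->
  \sum_l invmx (g u) k l * g u j l = (k == j)%:R.
Proof.
move=> Uu; have := mulVmx (g_unit Uu) => /matrixP/(_ k j); rewrite !mxE => <-.
by apply: eq_bigr => l _; rewrite (metric_symE g_sym j l).
Qed.

Variables (w : 'rV[R]_n -> R) (w_smooth : smooth_on U w).
Let h u := expR (2 * w u) *: g u.

Let e_neq0 u : expR (2 * w u) != 0. Proof. by rewrite gt_eqF ?expR_gt0. Qed.

Lemma chr_conformal k i j u : U u ->
  chr h k i j u = chr g k i j u + (k == j)%:R * partial i w u
    + (k == i)%:R * partial j w u - g u i j * grad_comp g w k u.
Proof.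
move=> Uu.
have dw : differentiable w u by exact: smooth_on_differentiable w_smooth Uu.
have dg p q : differentiable (fun v => g v p q) u.
  exact: smooth_on_differentiable (g_smooth p q) Uu.
have ph a p q : partial a (fun v => h v p q) u
    = expR (2 * w u) * (partial a (fun v => g v p q) u + 2 * partial a w u * g u p q).
  rewrite (_ : (fun v => h v p q) = fun v => expR (2 * w v) * g v p q); last first.
    by apply/funext => v; rewrite mxE.
  have d2 : differentiable (fun v => 2 * w v) u by exact: differentiableZ.
  rewrite partialM //; last exact: differentiable_expR.
  by rewrite partial_expR // partialZ //; ring.
rewrite /chr invmxZ; last by rewrite unitmxZ ?g_unit ?unitfE.
(* The Kronecker deltas are expanded as contractions of the inverse metric with g, so that both
   sides are sums over one index and can be compared termwise. *)
rewrite -!(invmx_mul_metric _ _ Uu) /grad_comp !mulr_suml !mulr_sumr.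
rewrite -!big_split -sumrB /=; apply: eq_bigr => l _.
rewrite mxE !ph; field; exact: e_neq0.
Qed.

Lemma hess_conformal F u : U u ->
  hess h F u = hess g F u - ((dd w u)^T *m dd F u + (dd F u)^T *m dd w u)
    + dprod g w F u *: g u.
Proof.
move=> Uu; apply/matrixP => i j; rewrite !mxE !big_ord1 !mxE.
under eq_bigr do rewrite chr_conformal // mulrBl 2!mulrDl -!(mulrA (_ == _)%:R) -(mulrA (g u i j)).
rewrite sumrB !big_split /= !sum_delta -[X in _ - (_ - X)]mulr_sumr.
have -> : \sum_k grad_comp g w k u * partial k F u = dprod g w F u.
  rewrite dprodE; apply: eq_bigr => k _; rewrite mulrC; congr (_ * _).
  by apply: eq_bigr => l _; rewrite mulrC (invmx_symE g_sym).
ring.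
Qed.

End Conformal.

(** * Ricci tensor of a doubly warped product *)

Section DoublyWarped.
Variables (R : realType) (n1 n2 : nat).
Variables (U1 : set 'rV[R]_n1) (U2 : set 'rV[R]_n2).
Variables (g : 'rV[R]_n1 -> 'M[R]_n1) (h : 'rV[R]_n2 -> 'M[R]_n2).
Variables (k : 'rV[R]_n1 -> R) (s : 'rV[R]_n2 -> R).
Hypotheses (oU1 : open U1) (oU2 : open U2).
Hypotheses (g_smooth : smooth_mx U1 g) (h_smooth : smooth_mx U2 h).
Hypotheses (g_sym : forall u, U1 u -> (g u)^T = g u).
Hypotheses (h_sym : forall u, U2 u -> (h u)^T = h u).
Hypotheses (g_unit : forall u, U1 u -> g u \in unitmx).
Hypotheses (h_unit : forall u, U2 u -> h u \in unitmx).
Hypotheses (k_smooth : smooth_on U1 k) (s_smooth : smooth_on U2 s).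
Implicit Types u : 'rV[R]_(n1 + n2).

Definition doubly_warped u : 'M[R]_(n1 + n2) :=
  block_mx (expR (2 * s (rsubmx u)) *: g (lsubmx u)) 0
           0 (expR (2 * k (lsubmx u)) *: h (rsubmx u)).
Local Notation G := doubly_warped.
Local Notation lf := (lshift n2).
Local Notation rt := (rshift n1).

Let W : set 'rV[R]_(n1 + n2) := [set u | U1 (lsubmx u) /\ U2 (rsubmx u)].

Lemma open_product_domain : open W.
Proof.
rewrite (_ : W = (lsubmx @^-1` U1) `&` (rsubmx @^-1` U2)) //.
apply: openI; apply: open_comp => // u _.
- exact: continuous_lsubmx.
- exact: continuous_rsubmx.
Qed.
Let oW := open_product_domain.

Let dk w : U1 w -> differentiable k w.
Proof. exact: smooth_on_differentiable. Qed.
Let ds z : U2 z -> differentiable s z.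
Proof. exact: smooth_on_differentiable. Qed.

(** In the names below [l] marks a base index and [r] a fiber index; in the [chr] lemmas the first
    letter is the upper index. The symbols with upper fiber index and two base indices do not enter
    the fiber block of the Ricci tensor, the only block computed. *)
Lemma warped_ll i j l u : W u ->
  partial (lf i) (fun v => G v (lf j) (lf l)) u
  = expR (2 * s (rsubmx u)) * partial i (fun w => g w j l) (lsubmx u).
Proof.
move=> [Ux Uy].
rewrite (_ : (fun v => G v _ _) = fun v => expR (2 * s (rsubmx v)) * g (lsubmx v) j l); last first.
  by apply/funext => v; rewrite block_mxEul mxE.
rewrite (partial_lshift i (fun w z => expR (2 * s z) * g w j l)) partialZ //.
exact: smooth_on_differentiable (g_smooth j l) Ux.
Qed.

Lemma warped_rll c j l u : W u ->
  partial (rt c) (fun v => G v (lf j) (lf l)) u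
  = expR (2 * s (rsubmx u)) * (2 * partial c s (rsubmx u)) * g (lsubmx u) j l.
Proof.
move=> [Ux Uy].
rewrite (_ : (fun v => G v _ _) = fun v => g (lsubmx v) j l * expR (2 * s (rsubmx v))).
  rewrite (partial_rshift c (fun w z => g w j l * expR (2 * s z))) partialZ.
    by rewrite partial_warp 1?mulrC //; apply: ds.
  exact/differentiable_warp/ds.
by apply/funext => v; rewrite block_mxEul mxE mulrC.
Qed.

Lemma warped_rr c d e u : W u ->
  partial (rt c) (fun v => G v (rt d) (rt e)) u
  = expR (2 * k (lsubmx u)) * partial c (fun z => h z d e) (rsubmx u).
Proof.
move=> [Ux Uy].
rewrite (_ : (fun v => G v _ _) = fun v => expR (2 * k (lsubmx v)) * h (rsubmx v) d e); last first.
  by apply/funext => v; rewrite block_mxEdr mxE.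
rewrite (partial_rshift c (fun w z => expR (2 * k w) * h z d e)) partialZ //.
exact: smooth_on_differentiable (h_smooth d e) Uy.
Qed.

Lemma warped_lrr i d e u : W u ->
  partial (lf i) (fun v => G v (rt d) (rt e)) u
  = expR (2 * k (lsubmx u)) * (2 * partial i k (lsubmx u)) * h (rsubmx u) d e.
Proof.
move=> [Ux Uy].
rewrite (_ : (fun v => G v _ _) = fun v => h (rsubmx v) d e * expR (2 * k (lsubmx v))).
  rewrite (partial_lshift i (fun w z => h z d e * expR (2 * k w))) partialZ.
    by rewrite partial_warp 1?mulrC //; apply: dk.
  exact/differentiable_warp/dk.
by apply/funext => v; rewrite block_mxEdr mxE mulrC.
Qed.

Lemma warped_lr I j e u : partial I (fun v => G v (lf j) (rt e)) u = 0.
Proof.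
rewrite (_ : (fun v => _) = fun _ => 0) ?partial_cst //.
by apply/funext => v; rewrite block_mxEur mxE.
Qed.

Lemma warped_rl I j e u : partial I (fun v => G v (rt e) (lf j)) u = 0.
Proof.
rewrite (_ : (fun v => _) = fun _ => 0) ?partial_cst //.
by apply/funext => v; rewrite block_mxEdl mxE.
Qed.

Let e_neq0 (a : R) : expR a != 0. Proof. by rewrite gt_eqF ?expR_gt0. Qed.

Lemma invmx_warped u : W u -> invmx (G u) =
  block_mx ((expR (2 * s (rsubmx u)))^-1 *: invmx (g (lsubmx u))) 0
           0 ((expR (2 * k (lsubmx u)))^-1 *: invmx (h (rsubmx u))).
Proof.
move=> [Ux Uy]; have ug := g_unit Ux; have uh := h_unit Uy.
have ug' := unitmxZ (g (lsubmx u)) (a := expR (2 * s (rsubmx u))).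
rewrite invmx_block_diag ?invmxZ // ?block_diag_mx_unit ?unitmxZ ?unitfE ?e_neq0 //.
by rewrite ug uh.
Qed.

Lemma chr_warpedl i I J u : W u -> chr G (lf i) I J u =
  2^-1 * \sum_l (expR (2 * s (rsubmx u)))^-1 * invmx (g (lsubmx u)) i l *
    (partial I (fun v => G v J (lf l)) u + partial J (fun v => G v I (lf l)) u
     - partial (lf l) (fun v => G v I J) u).
Proof.
move=> Wu; rewrite /chr invmx_warped // big_split_ord /= [X in _ + X]big1 ?addr0.
  by congr (_ * _); apply: eq_bigr => l _; rewrite block_mxEul mxE.
by move=> d _; rewrite block_mxEur mxE mul0r.
Qed.

Lemma chr_warpedr c I J u : W u -> chr G (rt c) I J u =
  2^-1 * \sum_d (expR (2 * k (lsubmx u)))^-1 * invmx (h (rsubmx u)) c d *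
    (partial I (fun v => G v J (rt d)) u + partial J (fun v => G v I (rt d)) u
     - partial (rt d) (fun v => G v I J) u).
Proof.
move=> Wu; rewrite /chr invmx_warped // big_split_ord /= big1 ?add0r.
  by congr (_ * _); apply: eq_bigr => l _; rewrite block_mxEdr mxE.
by move=> d _; rewrite block_mxEdl mxE mul0r.
Qed.

Lemma chr_lll l i j u : W u -> chr G (lf l) (lf i) (lf j) u = chr g l i j (lsubmx u).
Proof.
move=> Wu; rewrite chr_warpedl //; congr (_ * _); apply: eq_bigr => m _.
by rewrite !warped_ll //; field; exact: e_neq0.
Qed.

Lemma chr_rrr e c d u : W u -> chr G (rt e) (rt c) (rt d) u = chr h e c d (rsubmx u).
Proof.
move=> Wu; rewrite chr_warpedr //; congr (_ * _); apply: eq_bigr => m _.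
by rewrite !warped_rr //; field; exact: e_neq0.
Qed.

(** The fiber functions stand in front and the base functions in the last bracket, so that a base
    derivative treats the former as constants. *)
Lemma chr_lrr l c d u : W u -> chr G (lf l) (rt c) (rt d) u =
  - (expR (2 * s (rsubmx u)))^-1 * h (rsubmx u) c d
  * (expR (2 * k (lsubmx u)) * grad_comp g k l (lsubmx u)).
Proof.
move=> Wu; rewrite chr_warpedl // /grad_comp !mulr_sumr; apply: eq_bigr => m _.
by rewrite !warped_rl !warped_lrr //; field; exact: e_neq0.
Qed.

Lemma chr_llr l i c u : W u ->
  chr G (lf l) (lf i) (rt c) u = (l == i)%:R * partial c s (rsubmx u).
Proof.
move=> Wu; have [Ux _] := Wu; rewrite chr_warpedl //.
rewrite -(invmx_mul_metric g_sym g_unit _ _ Ux) mulr_suml mulr_sumr.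
apply: eq_bigr => m _; rewrite warped_rl warped_rll // warped_lr.
by field; exact: e_neq0.
Qed.

Lemma chr_lrl l i c u : W u ->
  chr G (lf l) (rt c) (lf i) u = (l == i)%:R * partial c s (rsubmx u).
Proof.
move=> Wu; have [Ux _] := Wu; rewrite chr_warpedl //.
rewrite -(invmx_mul_metric g_sym g_unit _ _ Ux) mulr_suml mulr_sumr.
apply: eq_bigr => m _; rewrite warped_rl warped_rll // warped_rl.
by field; exact: e_neq0.
Qed.

Lemma chr_rrl e c i u : W u ->
  chr G (rt e) (rt c) (lf i) u = (e == c)%:R * partial i k (lsubmx u).
Proof.
move=> Wu; have [_ Uy] := Wu; rewrite chr_warpedr //.
rewrite -(invmx_mul_metric h_sym h_unit _ _ Uy) mulr_suml mulr_sumr.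
apply: eq_bigr => m _; rewrite warped_lr warped_lrr // warped_rl.
by field; exact: e_neq0.
Qed.

Lemma chr_rlr e c i u : W u ->
  chr G (rt e) (lf i) (rt c) u = (e == c)%:R * partial i k (lsubmx u).
Proof.
move=> Wu; have [_ Uy] := Wu; rewrite chr_warpedr //.
rewrite -(invmx_mul_metric h_sym h_unit _ _ Uy) mulr_suml mulr_sumr.
apply: eq_bigr => m _; rewrite warped_lr warped_lrr // warped_lr.
by field; exact: e_neq0.
Qed.

Lemma dprod_grad_comp w : U1 w ->
  dprod g k k w = \sum_j partial j k w * grad_comp g k j w.
Proof.
move=> Uw; rewrite dprodE; apply: eq_bigr => j _; congr (_ * _).
by apply: eq_bigr => l _; rewrite mulrC (invmx_symE g_sym).
Qed.

(** The contracted index is either a base index ([ricl]) or a fiber index ([ricr]). The base indices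
    give the divergence of grad k and -PQ; the n2 fiber indices give -n2 PQ, and the one equal to
    [a] returns PQ. The coefficient of |dk|^2 is therefore n2. *)
Lemma ric_warped a b u : W u ->
  ric G u (rt a) (rt b) = ric h (rsubmx u) a b
   - n1%:R * (hess h s (rsubmx u) a b
              + partial a s (rsubmx u) * partial b s (rsubmx u))
   - (expR (2 * s (rsubmx u)))^-1 * expR (2 * k (lsubmx u))
     * (\tr (invmx (g (lsubmx u)) *m hess g k (lsubmx u))
        + n2%:R * dprod g k k (lsubmx u)) * h (rsubmx u) a b.
Proof.
move=> Wu; have [Ux Uy] := Wu.
set x := lsubmx u in Ux *; set y := rsubmx u in Uy *.
(* P is the common coefficient e^(2k - 2s) h_ab and Q is |dk|^2; both stay opaque until [PE] and
   [QE] are used. *)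
have [P PE] : {P | P = (expR (2 * s y))^-1 * h y a b * expR (2 * k x)} by eexists.
have [Q QE] : {Q | Q = \sum_j partial j k x * grad_comp g k j x} by eexists.
have pgam i : partial (lf i) (chr G (lf i) (rt a) (rt b)) u
    = - P * (partial i (grad_comp g k i) x + 2 * (partial i k x * grad_comp g k i x)).
  rewrite (eq_partial_on (G := fun v => - (expR (2 * s (rsubmx v)))^-1 * h (rsubmx v) a b
    * (expR (2 * k (lsubmx v)) * grad_comp g k i (lsubmx v))) (lf i) oW Wu); last first.
    by move=> v; rewrite inE => Wv; rewrite chr_lrr.
  have dgc : differentiable (grad_comp g k i) x.
    apply: smooth_on_differentiable (Ux).
    exact: (grad_comp_smooth oU1 g_smooth g_unit).
  have dek : differentiable (fun w => expR (2 * k w)) x by apply/differentiable_warp/dk.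
  rewrite (partial_lshift i (fun w z => - (expR (2 * s z))^-1 * h z a b
    * (expR (2 * k w) * grad_comp g k i w))).
  rewrite partialZ; last exact: differentiableM.
  rewrite partialM // partial_warp; [| exact: dk].
  rewrite PE -/x -/y.
  move: (expR _) (expR _)^-1 (h _ _ _) (partial i k _) (grad_comp _ _ _ _) (partial i _ _).
  by move=> ? ? ? ? ? ?; ring.
have ptr i : partial (rt a) (chr G (lf i) (lf i) (rt b)) u = partial a (partial b s) y.
  rewrite (eq_partial_on (G := fun v => partial b s (rsubmx v)) (rt a) oW Wu).
    by rewrite (partial_rshift a (fun _ z => partial b s z)).
  by move=> v; rewrite inE => Wv; rewrite chr_llr // eqxx mul1r.
have prr c e f d : partial (rt c) (chr G (rt e) (rt f) (rt d)) u = partial c (chr h e f d) y.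
  rewrite (eq_partial_on (G := fun v => chr h e f d (rsubmx v)) (rt c) oW Wu).
    by rewrite (partial_rshift c (fun _ z => chr h e f d z)).
  by move=> v; rewrite inE => Wv; rewrite chr_rrr.
(* Differentiating e^(2k) gives the gradient term twice; a product of mixed symbols takes one copy
   back. *)
have ricl i : partial (lf i) (chr G (lf i) (rt a) (rt b)) u
    - partial (rt a) (chr G (lf i) (lf i) (rt b)) u
    + \sum_m (chr G (lf i) (lf i) m u * chr G m (rt a) (rt b) u
              - chr G (lf i) (rt a) m u * chr G m (lf i) (rt b) u)
    = - P * (partial i (grad_comp g k i) x + \sum_j chr g i i j x * grad_comp g k j x)
      - P * (partial i k x * grad_comp g k i x)
      - (hess h s y a b + partial a s y * partial b s y).
  rewrite pgam ptr big_split_ord /=.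
  have -> : \sum_j (chr G (lf i) (lf i) (lf j) u * chr G (lf j) (rt a) (rt b) u
              - chr G (lf i) (rt a) (lf j) u * chr G (lf j) (lf i) (rt b) u)
      = - P * (\sum_j chr g i i j x * grad_comp g k j x) - partial a s y * partial b s y.
    rewrite mulr_sumr -[partial a s y](sum_delta i (fun _ => partial a s y)).
    rewrite mulr_suml -sumrB; apply: eq_bigr => j _.
    rewrite chr_lll // chr_lrr // chr_lrl // chr_llr // (eq_sym i j) -/x -/y PE.
    move: (expR _) (expR _)^-1 (h _ _ _) (chr _ _ _ _ _) (grad_comp _ _ _ _).
    move: (partial a _ _) (partial b _ _) => ? ? ? ? ? ? ?.
    by case: (j == i) => /=; ring.
  have -> : \sum_c (chr G (lf i) (lf i) (rt c) u * chr G (rt c) (rt a) (rt b) u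
              - chr G (lf i) (rt a) (rt c) u * chr G (rt c) (lf i) (rt b) u)
      = \sum_c chr h c a b y * partial c s y + P * (partial i k x * grad_comp g k i x).
    rewrite sumrB; congr (_ + _).
      by apply: eq_bigr => c _; rewrite chr_llr // chr_rrr // eqxx mul1r mulrC.
    under eq_bigr => c _ do rewrite chr_rlr // mulrC -mulrA.
    rewrite sum_delta chr_lrr // -/x -/y PE.
    by move: (expR _) (expR _)^-1 (h _ _ _) (partial _ _ _) (grad_comp _ _ _ _) => ? ? ? ? ?; ring.
  rewrite [in RHS]mxE; move: (partial a (partial b s) y) (partial a s y) (partial b s y).
  move: (\sum_c _) (\sum_j _) (partial i (grad_comp _ _ _) _) (partial i k x).
  by move: (grad_comp _ _ _ _) => ? ? ? ? ? ? ? ?; ring.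
have ricr c : partial (rt c) (chr G (rt c) (rt a) (rt b)) u
    - partial (rt a) (chr G (rt c) (rt c) (rt b)) u
    + \sum_m (chr G (rt c) (rt c) m u * chr G m (rt a) (rt b) u
              - chr G (rt c) (rt a) m u * chr G m (rt c) (rt b) u)
    = (partial c (chr h c a b) y - partial a (chr h c c b) y
       + \sum_d (chr h c c d y * chr h d a b y - chr h c a d y * chr h d c b y))
      - P * Q + (c == a)%:R * (P * Q).
  rewrite !prr big_split_ord /=.
  have -> : \sum_j (chr G (rt c) (rt c) (lf j) u * chr G (lf j) (rt a) (rt b) u
              - chr G (rt c) (rt a) (lf j) u * chr G (lf j) (rt c) (rt b) u)
      = - P * Q + (c == a)%:R * (P * Q).
    rewrite QE !mulr_sumr -big_split; apply: eq_bigr => j _ /=.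
    rewrite !chr_rrl // !chr_lrr // eqxx -/x -/y PE.
    case: eqP => [->|_] /=; move: (expR _) (expR _)^-1 (h _ _ _) (partial _ _ _).
      by move: (grad_comp _ _ _ _) => ? ? ? ? ?; ring.
    by move: (grad_comp _ _ _ _) (h _ _ _) => ? ? ? ? ? ?; ring.
  under [X in _ + (_ + X) = _]eq_bigr do rewrite !chr_rrr //.
  rewrite -/y; move: (partial c _ _) (partial a _ _) (\sum_d _) => ? ? ?; ring.
rewrite mxE big_split_ord /=.
under eq_bigr do rewrite ricl.
under [X in _ + X]eq_bigr do rewrite ricr.
rewrite !big_split /= !sum_delta -!mulr_sumr.
rewrite (divergence_grad oU1 g_smooth g_sym g_unit k_smooth Ux).
rewrite dprod_grad_comp // -QE !sumr_const !card_ord.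
have -> : ric h y a b = \sum_c partial c (chr h c a b) y
    + \sum_c - partial a (chr h c c b) y
    + \sum_c \sum_d (chr h c c d y * chr h d a b y - chr h c a d y * chr h d c b y).
  by rewrite mxE -!big_split.
have -> : \sum_i - (P * (partial i k x * grad_comp g k i x)) = - (P * Q).
  by rewrite QE mulr_sumr sumrN.
rewrite PE.
move: (\tr _) (\sum_c _) (\sum_c _) (\sum_c _) (hess _ _ _ _ _) (partial _ _ _) (partial _ _ _).
move: (expR _) (expR _)^-1 (h _ _ _) => ? ? ? ? ? ? ? ? ? ?.
by rewrite -(mulr_natl (- (_ + _))) -(mulr_natl (- (_ * _))); ring.
Qed.

(** * Lie derivative along a projectable field *)

Section LieDerivative.
Variables (X : 'rV[R]_(n1 + n2) -> 'rV[R]_(n1 + n2)).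
Variables (X1 : 'rV[R]_n1 -> 'rV[R]_n1) (X2 : 'rV[R]_n2 -> 'rV[R]_n2).
Hypothesis X_split : forall u, W u -> X u = row_mx (X1 (lsubmx u)) (X2 (rsubmx u)).

Lemma partial_split_ll i j u : W u ->
  partial (lf i) (fun v => X v 0 (lf j)) u = partial i (fun w => X1 w 0 j) (lsubmx u).
Proof.
move=> Wu; rewrite (eq_partial_on (G := fun v => X1 (lsubmx v) 0 j) (lf i) oW Wu).
  by rewrite (partial_lshift i (fun w _ => X1 w 0 j)).
by move=> v; rewrite inE => Wv; rewrite X_split // row_mxEl.
Qed.

Lemma partial_split_rr i j u : W u ->
  partial (rt i) (fun v => X v 0 (rt j)) u = partial i (fun w => X2 w 0 j) (rsubmx u).
Proof.
move=> Wu; rewrite (eq_partial_on (G := fun v => X2 (rsubmx v) 0 j) (rt i) oW Wu).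
  by rewrite (partial_rshift i (fun _ w => X2 w 0 j)).
by move=> v; rewrite inE => Wv; rewrite X_split // row_mxEr.
Qed.

Lemma lie_warped_ll i j u : W u -> lie X G u (lf i) (lf j) =
  expR (2 * s (rsubmx u)) * (lie X1 g (lsubmx u) i j
    + 2 * (X2 (rsubmx u) *m (dd s (rsubmx u))^T) 0 0 * g (lsubmx u) i j).
Proof.
move=> Wu; rewrite [LHS]mxE big_split_ord /= mulrDr [in RHS]mxE mulr_sumr.
congr (_ + _).
  apply: eq_bigr => l _; rewrite warped_ll // !partial_split_ll // X_split //.
  by rewrite row_mxEl /G !block_mxEul !mxE; ring.
rewrite mxE !(mulr_sumr, mulr_suml); apply: eq_bigr => c _.
rewrite warped_rll // X_split // row_mxEr /G block_mxEdl block_mxEur !mxE; ring.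
Qed.

Lemma lie_warped_rr a b u : W u -> lie X G u (rt a) (rt b) =
  expR (2 * k (lsubmx u)) * (lie X2 h (rsubmx u) a b
    + 2 * (X1 (lsubmx u) *m (dd k (lsubmx u))^T) 0 0 * h (rsubmx u) a b).
Proof.
move=> Wu; rewrite [LHS]mxE big_split_ord /= addrC mulrDr [in RHS]mxE mulr_sumr.
congr (_ + _).
  apply: eq_bigr => l _; rewrite warped_rr // !partial_split_rr // X_split //.
  by rewrite row_mxEr /G !block_mxEdr !mxE; ring.
rewrite mxE !(mulr_sumr, mulr_suml); apply: eq_bigr => c _.
rewrite warped_lrr // X_split // row_mxEl /G block_mxEdl block_mxEur !mxE; ring.
Qed.

(** The conformal factors cancel against those of the inverse metric. This is twice the divergence
    of X, and it enters the traced soliton equation. *)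
Lemma trace_lie_warped u : W u -> \tr (invmx (G u) *m lie X G u) =
  \tr (invmx (g (lsubmx u)) *m lie X1 g (lsubmx u))
  + n1%:R * (2 * (X2 (rsubmx u) *m (dd s (rsubmx u))^T) 0 0)
  + (\tr (invmx (h (rsubmx u)) *m lie X2 h (rsubmx u))
     + n2%:R * (2 * (X1 (lsubmx u) *m (dd k (lsubmx u))^T) 0 0)).
Proof.
move=> Wu; have [Ux Uy] := Wu.
have ll : ulsubmx (lie X G u) = expR (2 * s (rsubmx u)) *: (lie X1 g (lsubmx u)
    + (2 * (X2 (rsubmx u) *m (dd s (rsubmx u))^T) 0 0) *: g (lsubmx u)).
  apply/matrixP => i j; transitivity (lie X G u (lf i) (lf j)).
    by rewrite [LHS]mxE [LHS]mxE.
  by rewrite lie_warped_ll //; move: (lie X1 _ _) => L; rewrite !mxE.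
have rr : drsubmx (lie X G u) = expR (2 * k (lsubmx u)) *: (lie X2 h (rsubmx u)
    + (2 * (X1 (lsubmx u) *m (dd k (lsubmx u))^T) 0 0) *: h (rsubmx u)).
  apply/matrixP => i j; transitivity (lie X G u (rt i) (rt j)).
    by rewrite [LHS]mxE [LHS]mxE.
  by rewrite lie_warped_rr //; move: (lie X2 _ _) => L; rewrite !mxE.
rewrite invmx_warped // -[lie X G u]submxK ll rr mulmx_block !mul0mx addr0 add0r.
rewrite mxtrace_block -!scalemxAl -!scalemxAr !scalerA !mulVf ?e_neq0 // !scale1r.
rewrite !mulmxDr -!scalemxAr !mulVmx ?g_unit ?h_unit // !mxtraceD !mxtraceZ !mxtrace1.
by rewrite mxtrace0 add0r ![_ * _%:R]mulrC.
Qed.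

End LieDerivative.

End DoublyWarped.

(** * Change of charts for first-order quantities *)

Section ChartInvariance.
Variables (R : realType) (n : nat) (M : charted R n).
Hypothesis M_mfd : smooth_manifold M.
Implicit Types (c d : atlas M) (p : M) (F H : M -> R).

Lemma img_chart c p : dom c p -> img c (chart c p).
Proof. by move=> cp; exists p. Qed.

Lemma dom_chart_inv c u : img c u -> dom c (chart_inv c u).
Proof. by move=> [p cp <-]; rewrite (mfd_chartK M_mfd). Qed.

Lemma chart_invK c u : img c u -> chart c (chart_inv c u) = u.
Proof. by move=> [p cp <-]; rewrite (mfd_chartK M_mfd). Qed.

Lemma dif_chart F c d p : smooth_fun F -> dom c p -> dom d p ->
  dif F c (chart c p) = dif F d (chart d p) *m (jac c d (chart c p))^T.
Proof.
move=> sF cp dp; apply/rowP => i; rewrite !mxE.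
have e : trans c d (chart c p) = chart d p by rewrite /trans (mfd_chartK M_mfd).
transitivity (partial i (fun v => (F \o chart_inv d) (trans c d v)) (chart c p)).
  (* The two coordinate expressions of F agree wherever the point lies in the domain of [d], which
     holds near the given point by continuity of [chart_inv]. *)
  apply: near_eq_derive.
  have := mfd_chart_inv_continuous M_mfd (img_chart cp).
  rewrite /prop_for /continuous_at (mfd_chartK M_mfd) //.
  move=> /(_ _ (open_nbhs_nbhs (conj (mfd_dom_open M_mfd d) dp))) nd.
  have {}nd : \forall v \near chart c p, dom d (chart_inv c v) by exact: nd.
  by apply: filterS nd => v dv; rewrite /trans /= (mfd_chartK M_mfd).
rewrite partial_comp ?e.
- by apply: eq_bigr => a _; rewrite !mxE mulrC.
- move=> a; apply: smooth_on_differentiable (mfd_trans_smooth M_mfd a) _.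
  by exists p.
- exact: smooth_on_differentiable (sF d) (img_chart dp).
Qed.

Lemma vapplyE (X : vfield M) F c p : is_vfield X -> smooth_fun F -> dom c p ->
  vapply X F p = (X c (chart c p) *m (dd (F \o chart_inv c) (chart c p))^T) 0 0.
Proof.
move=> [_ tX] sF cp; have dp := mfd_cover M_mfd p.
rewrite /vapply -[dd _ _]/(dif F c (chart c p)) (dif_chart sF cp dp).
by rewrite trmx_mul trmxK mulmxA (tX _ _ _ cp dp).
Qed.

Lemma inner_gradE (g : tensor02 M) F H c p : pseudo_metric g ->
    smooth_fun F -> smooth_fun H -> dom c p ->
  inner g (grad g F) (grad g H) p
  = dprod (g c) (F \o chart_inv c) (H \o chart_inv c) (chart c p).
Proof.
move=> [[_ tg] mg] sF sH cp; have dp := mfd_cover M_mfd p.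
have [gs gu] := mg _ _ (img_chart dp); have [cs cu] := mg _ _ (img_chart cp).
rewrite /inner /grad /dprod trmx_mul trmx_inv gs mulmxKV //.
rewrite -[dd _ _]/(dif F c (chart c p)) -[dd _ _]/(dif H c (chart c p)).
rewrite (dif_chart sF cp dp) (dif_chart sH cp dp) trmx_mul trmxK.
rewrite !mulmxA; congr ((_ *m _) 0 0); rewrite -!mulmxA; congr (_ *m _).
set d := chart_at p in dp *; set J := jac c d (chart c p).
have gJ := tg _ _ _ cp dp.
(* The Jacobian is invertible because it is a factor of the nondegenerate matrix of g in the chart
   [c]. *)
have uJ : J \in unitmx by move: cu; rewrite gJ !unitmx_mul => /andP[/andP[]].
rewrite -/J in gJ; apply: (can_inj (mulKmx gu)); rewrite mulmxV //.
apply: (can_inj (mulKmx uJ)); rewrite mulmx1 !mulmxA -gJ mulmxV //.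
by rewrite mul1mx.
Qed.

Lemma smooth_fun_chartwise F (f : forall c, 'rV[R]_n -> R) :
    (forall c, smooth_on (img c) (f c)) ->
    (forall c p, dom c p -> F p = f c (chart c p)) -> smooth_fun F.
Proof.
move=> sf Ff c; have oc := mfd_img_open (c := c) M_mfd.
apply: (eq_smooth_on oc (F := f c)) => // u; rewrite inE => cu.
by rewrite /= (Ff c) ?chart_invK //; apply: dom_chart_inv.
Qed.

Lemma smooth_fun_cst (a : R) : smooth_fun (fun _ : M => a).
Proof. by move=> c; apply: smooth_on_cst; apply: mfd_img_open. Qed.

Lemma smooth_funD F H : smooth_fun F -> smooth_fun H -> smooth_fun (fun p => F p + H p).
Proof. by move=> sF sH c; apply: smooth_onD => //; apply: mfd_img_open. Qed.

Lemma smooth_funM F H : smooth_fun F -> smooth_fun H -> smooth_fun (fun p => F p * H p).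
Proof. by move=> sF sH c; apply: smooth_onM => //; apply: mfd_img_open. Qed.

Lemma smooth_funB F H : smooth_fun F -> smooth_fun H -> smooth_fun (fun p => F p - H p).
Proof. by move=> sF sH c; apply: smooth_onB => //; apply: mfd_img_open. Qed.

Lemma smooth_fun_expR F : smooth_fun F -> smooth_fun (fun p => expR (F p)).
Proof. by move=> sF c; apply: smooth_on_expR => //; apply: mfd_img_open. Qed.

Lemma smooth_vapply (X : vfield M) F : is_vfield X -> smooth_fun F ->
  smooth_fun (vapply X F).
Proof.
move=> vX sF; have [sX _] := vX.
apply: (smooth_fun_chartwise (f := fun c u => (X c u *m (dd (F \o chart_inv c) u)^T) 0 0)).
  move=> c; have oc := mfd_img_open (c := c) M_mfd.
  apply: smooth_mxM => // [i j|]; first by rewrite ord1; exact: sX.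
  apply: smooth_mx_tr => i j; under [X in smooth_on _ X]funext do rewrite mxE.
  exact: smooth_on_partial.
by move=> c p cp; exact: vapplyE.
Qed.

Lemma smooth_inner_grad (g : tensor02 M) F H : pseudo_metric g ->
  smooth_fun F -> smooth_fun H -> smooth_fun (inner g (grad g F) (grad g H)).
Proof.
move=> mg sF sH; have [[sg _] ug] := mg.
apply: (smooth_fun_chartwise
  (f := fun c => dprod (g c) (F \o chart_inv c) (H \o chart_inv c))); last first.
  by move=> c p cp; exact: inner_gradE.
move=> c; have oc := mfd_img_open (c := c) M_mfd.
apply: smooth_mxM => //; first apply: smooth_mxM => //.
- move=> i j; under [X in smooth_on _ X]funext do rewrite mxE.
  exact: smooth_on_partial.
- apply: smooth_mx_inv => // u /ug[] //.
- apply: smooth_mx_tr => i j; under [X in smooth_on _ X]funext do rewrite mxE.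
  exact: smooth_on_partial.
Qed.

(* The factor of proportionality of two tensors is recovered as a trace in any
   one chart, hence is smooth although no trace is shown to be chart independent. *)
Lemma smooth_proportionality (g S : tensor02 M) (mu : M -> R) : (0 < n)%N ->
    (forall c, smooth_mx (img c) (g c)) ->
    (forall c u, img c u -> g c u \in unitmx) ->
    (forall c, smooth_mx (img c) (S c)) ->
  field_eq S (tscale mu g) -> smooth_fun mu.
Proof.
move=> n_gt0 sg ug sS Smu.
apply: (smooth_fun_chartwise (f := fun c u => n%:R^-1 * \tr (invmx (g c u) *m S c u))).
  move=> c; have oc := mfd_img_open (c := c) M_mfd.
  apply: smooth_onM => //; first exact: smooth_on_cst.
  apply: smooth_on_mxtrace => //; apply: smooth_mxM => //.
  by apply: smooth_mx_inv => // u; exact: ug.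
move=> c p cp; have cu := img_chart cp; rewrite Smu // /tscale -scalemxAr.
rewrite mulVmx ?ug // mxtraceZ mxtrace1 (mfd_chartK M_mfd) // mulrC mulfK //.
by rewrite pnatr_eq0 -lt0n.
Qed.

Lemma trace_tscale (g S : tensor02 M) (mu : M -> R) p :
    (forall c u, img c u -> g c u \in unitmx) ->
  field_eq S (tscale mu g) -> trace g S p = n%:R * mu p.
Proof.
move=> ug Smu; have cp := img_chart (mfd_cover M_mfd p).
rewrite /trace Smu // /tscale -scalemxAr mulVmx ?ug // mxtraceZ mxtrace1.
by rewrite (mfd_chartK M_mfd (mfd_cover M_mfd p)) mulrC.
Qed.

(** A factor of proportionality is necessarily the trace divided by n. No smoothness of [mu] is
    claimed here; [smooth_proportionality] supplies it for smooth tensors. *)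
Lemma tracefree_eq0 (g S : tensor02 M) : (0 < n)%N ->
    (forall c u, img c u -> g c u \in unitmx) ->
  field_eq (tracefree g S) (fun _ _ => 0) <->
  exists mu : M -> R, field_eq S (tscale mu g).
Proof.
move=> n_gt0 ug; have n0 : n%:R != 0 :> R by rewrite pnatr_eq0 -lt0n.
split=> [S0|[mu Smu] c u cu].
  exists (fun p => n%:R^-1 * trace g S p) => c u cu.
  by apply/eqP; rewrite -subr_eq0; apply/eqP; exact: S0.
rewrite /tracefree Smu // /tscale (trace_tscale _ ug Smu) mulKf //.
by rewrite subrr.
Qed.

End ChartInvariance.

(** * Derivatives after subtracting a constant *)

Section ShiftInvariance.
Variables (R : realType) (n : nat) (U : set 'rV[R]_n).
Hypothesis oU : open U.
Variables (F : 'rV[R]_n -> R) (a : R).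
Hypothesis F_smooth : smooth_on U F.

Lemma partial_subC i u : U u -> partial i (fun v => F v - a) u = partial i F u.
Proof.
move=> Uu; have dF := smooth_on_differentiable F_smooth Uu.
rewrite (partialD i dF (differentiable_cst_fun u (- a))) partial_cst addr0 //.
Qed.

Lemma dd_subC u : U u -> dd (fun v => F v - a) u = dd F u.
Proof. by move=> Uu; apply/rowP => i; rewrite !mxE partial_subC. Qed.

Lemma hess_subC g u : U u -> hess g (fun v => F v - a) u = hess g F u.
Proof.
move=> Uu; apply/matrixP => i j; rewrite !mxE.
have -> : partial i (partial j (fun v => F v - a)) u = partial i (partial j F) u.
  by apply: (eq_partial_on i oU Uu) => v; rewrite inE; exact: partial_subC.
by congr (_ - _); apply: eq_bigr => l _; rewrite partial_subC.
Qed.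

End ShiftInvariance.

Lemma trace_soliton_mx (F : fieldType) (n : nat) (G S L : 'M[F]_n) (a : F) :
    G \in unitmx -> S + 2^-1 *: L = a *: G ->
  \tr (invmx G *m S) = n%:R * a - 2^-1 * \tr (invmx G *m L).
Proof.
move=> uG /(canRL (addrK _)) ->; rewrite mulmxBr -!scalemxAr mulVmx //.
by rewrite raddfB /= !mxtraceZ mxtrace1 mulrC.
Qed.

(** * Conformal geometry of one fiber *)

Section FiberGeometry.
Variables (R : realType) (n : nat) (M : charted R n).
Hypothesis M_mfd : smooth_manifold M.
Variables (g : tensor02 M) (k s : M -> R).
Hypotheses (g_metric : pseudo_metric g) (k_smooth : smooth_fun k).
Hypothesis s_smooth : smooth_fun s.

(** The constant [a] stands for k1(x), the only trace of the base point in the slice metric. *)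
Definition fiber_metric (a : R) : tensor02 M :=
  tscale (fun y => expR (2 * a) * expR (2 * (k y + s y))) g.

Definition conformal_tensor : tensor02 M := fun c u =>
  Hess g s c u - (otimes (dif k) (dif s) c u + otimes (dif s) (dif k) c u)
  - otimes (dif s) (dif s) c u.

Definition conformal_scalar (y : M) : R :=
  inner g (grad g k) (grad g s) y + inner g (grad g s) (grad g s) y.

Let factor_neq0 (a b : R) : expR a * expR b != 0.
Proof. by rewrite gt_eqF ?mulr_gt0 ?expR_gt0. Qed.

Lemma pseudo_metric_smooth c : smooth_mx (img c) (g c).
Proof. by have [[sg _] _] := g_metric; exact: sg. Qed.

Lemma pseudo_metric_unit c u : img c u -> g c u \in unitmx.
Proof. by have [_ mg] := g_metric; move=> /mg[]. Qed.

Lemma pseudo_metric_sym c u : img c u -> (g c u)^T = g c u.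
Proof. by have [_ mg] := g_metric; move=> /mg[]. Qed.

Lemma fiber_metric_smooth a c : smooth_mx (img c) (fiber_metric a c).
Proof.
move=> i j; have oc := mfd_img_open (c := c) M_mfd.
under [X in smooth_on _ X]funext do rewrite mxE.
apply: smooth_onM => //; last exact: pseudo_metric_smooth.
apply: smooth_onM => //; first exact: smooth_on_cst.
apply: smooth_on_expR => //; apply: smooth_onM => //; first exact: smooth_on_cst.
by apply: smooth_onD => //.
Qed.

Lemma fiber_metric_unit a c u : img c u -> fiber_metric a c u \in unitmx.
Proof. by move=> cu; rewrite unitmxZ ?pseudo_metric_unit ?unitfE. Qed.

Lemma fiber_metric_sym a c u : img c u -> (fiber_metric a c u)^T = fiber_metric a c u.
Proof. by move=> cu; rewrite /fiber_metric /tscale linearZ /= pseudo_metric_sym. Qed.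

(** The conformal exponent is w = a + k + s, so dw = dk + ds. The change of the Hessian thus
    contains -2 ds (x) ds, of which the added square leaves one copy. *)
Lemma hess_fiber a c v : img c v ->
  hess (fiber_metric a c) (s \o chart_inv c) v
    + (dd (s \o chart_inv c) v)^T *m dd (s \o chart_inv c) v
  = conformal_tensor c v + conformal_scalar (chart_inv c v) *: g c v.
Proof.
move=> cv; have oc := mfd_img_open (c := c) M_mfd.
set K := k \o chart_inv c; set S := s \o chart_inv c.
pose w v := a + (K v + S v).
have sK : smooth_on (img c) K by exact: k_smooth.
have sS : smooth_on (img c) S by exact: s_smooth.
have sw : smooth_on (img c) w.
  by apply: smooth_onD => //; [exact: smooth_on_cst | exact: smooth_onD].
have -> : fiber_metric a c = fun v => expR (2 * w v) *: g c v.
  by apply/funext => z; rewrite /fiber_metric /tscale -expRD -mulrDr.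
have dw : dd w v = dd K v + dd S v.
  have dK := smooth_on_differentiable sK cv; have dS := smooth_on_differentiable sS cv.
  apply/rowP => i; rewrite !mxE /w.
  rewrite (partialD i (differentiable_cst_fun v a)); last exact: differentiableD.
  by rewrite partial_cst add0r partialD.
rewrite (hess_conformal (@pseudo_metric_smooth c) (@pseudo_metric_sym c)
  (@pseudo_metric_unit c) sw) //.
have -> : dprod (g c) w S v = conformal_scalar (chart_inv c v).
  have cy := dom_chart_inv M_mfd cv.
  rewrite /conformal_scalar !(inner_gradE M_mfd (c := c)) // (chart_invK M_mfd cv).
  by rewrite /dprod dw !mulmxDl mxE.
rewrite dw [(_ + _)^T]linearD /= mulmxDl mulmxDr.
rewrite /conformal_tensor -[Hess g s c v]/(hess (g c) S v) /otimes.
rewrite -[dif s c v]/(dd S v) -[dif k c v]/(dd K v).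
rewrite addrAC; congr (_ + _).
move: (hess _ _ _) (_ *m dd K v) (_ *m dd S v) (_ *m dd S v) => A B C D.
by rewrite addrACA !opprD !addrA addrNK.
Qed.

Lemma conformal_tensor_smooth c : smooth_mx (img c) (conformal_tensor c).
Proof.
have oc := mfd_img_open (c := c) M_mfd => i j.
under [X in smooth_on _ X]funext do rewrite !mxE !big_ord1 !mxE.
have sK : smooth_on (img c) (k \o chart_inv c) by exact: k_smooth.
have sS : smooth_on (img c) (s \o chart_inv c) by exact: s_smooth.
have pK l := smooth_on_partial l sK; have pS l := smooth_on_partial l sS.
apply: smooth_onB => //; last exact: smooth_onM.
apply: smooth_onB => //; last by apply: smooth_onD => //; exact: smooth_onM.
apply: smooth_onB => //; first exact: smooth_on_partial.
apply: smooth_on_sum => // l _; apply: smooth_onM => //.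
apply: (chr_smooth oc (@pseudo_metric_smooth c) (@pseudo_metric_unit c)).
Qed.

Lemma conformal_scalar_smooth : smooth_fun conformal_scalar.
Proof. by apply: smooth_funD => //; exact: smooth_inner_grad. Qed.

Lemma soliton_tensor_smooth a (X : vfield M) c : is_vfield X ->
  smooth_mx (img c) (fun u => Ric (fiber_metric a) c u + 2^-1 *: Lie X (fiber_metric a) c u).
Proof.
have oc := mfd_img_open (c := c) M_mfd => -[sX _] i j.
have sh := @fiber_metric_smooth a c.
have sC p q r : smooth_on (img c) (christoffel (fiber_metric a) c p q r).
  exact: (chr_smooth oc sh (@fiber_metric_unit a c)).
under [X in smooth_on _ X]funext do rewrite !mxE.
apply: smooth_onD => //.
  apply: smooth_on_sum => // l _; apply: smooth_onD => //.
    by apply: smooth_onB => //; exact: smooth_on_partial.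
  by apply: smooth_on_sum => // m _; apply: smooth_onB => //; exact: smooth_onM.
apply: smooth_onM => //; first exact: smooth_on_cst.
apply: smooth_on_sum => // l _; apply: smooth_onD => //; first apply: smooth_onD => //.
all: apply: smooth_onM => //; try exact: smooth_on_partial.
all: apply: smooth_on_partial; exact: sX.
Qed.

End FiberGeometry.

(** * The soliton equation on the product and on its slices *)

Section LyraSoliton.
Variables (R : realType) (n1 n2 : nat).
Variables (M1 : charted R n1) (M2 : charted R n2).
Hypotheses (n1_gt0 : (0 < n1)%N) (n2_gt0 : (0 < n2)%N).
Hypotheses (M1_mfd : smooth_manifold M1) (M2_mfd : smooth_manifold M2).
Variables (g1 : tensor02 M1) (g2 : tensor02 M2).
Hypotheses (g1_metric : pseudo_metric g1) (g2_metric : pseudo_metric g2).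
Variables (f phi : mprod M1 M2 -> R).
Hypotheses (f_gt0 : forall p, 0 < f p) (phi_gt0 : forall p, 0 < phi p).
Variables (Z : vfield (mprod M1 M2)) (Z1 : vfield M1) (Z2 : vfield M2).
Hypotheses (Z1_vfield : is_vfield Z1) (Z2_vfield : is_vfield Z2).
Hypothesis Z_proj : projectable Z Z1 Z2.
Variables (lam : mprod M1 M2 -> R) (rho : R).
Variables (k1 : M1 -> R) (k2 s2 : M2 -> R).
Hypotheses (k1_smooth : smooth_fun k1) (k2_smooth : smooth_fun k2).
Hypothesis s2_smooth : smooth_fun s2.
Hypothesis k_split : forall x y, ln (f (x, y)) = k1 x + k2 y.
Hypothesis s_split : forall x y, ln (phi (x, y)) = s2 y.

Local Notation gL := (lyra_metric g1 g2 f phi).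
Local Notation h2 x := (fiber_metric g2 k2 s2 (k1 x)).
Local Notation C2 := (conformal_tensor g2 k2 s2).
Local Notation c2 := (conformal_scalar g2 k2 s2).

Hypothesis soliton : almost_RB_soliton gL Z lam rho.

Definition base_scalar (x : M1) : R :=
  Lap g1 k1 x + n2%:R * inner g1 (grad g1 k1) (grad g1 k1) x.
Local Notation a1 := base_scalar.

Local Notation Phi x y := (lam (x, y) + rho * scal gL (x, y)).

Lemma f_exp x y : f (x, y) = expR (k1 x + k2 y).
Proof. by rewrite -k_split lnK // posrE. Qed.

Lemma phi_exp x y : phi (x, y) = expR (s2 y).
Proof. by rewrite -(s_split x) lnK // posrE. Qed.

Let shift x (w : 'rV[R]_n1) : R := (k1 \o chart_inv (chart_at x)) w - k1 x.

(** The fiber factor is e^(2 s2) f^2 = e^(2(k1 - k1(x))) e^(2(k1(x) + k2 + s2)), the second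
    exponential being that of the slice metric. *)
Lemma lyra_metricE x (c : atlas M2) : gL (chart_at x, c) =
  doubly_warped (g1 (chart_at x)) (h2 x c) (shift x) (s2 \o chart_inv c).
Proof.
apply/funext => u; rewrite /lyra_metric /twisted_metric /tscale /pull1 /pull2.
rewrite /doubly_warped /fiber_metric /tscale /= f_exp phi_exp.
rewrite scale_block_mx add_block_mx scale_block_mx !scaler0 !addr0 !scaler0 add0r.
rewrite !scalerA /shift /= -!expRM_natl -!expRD.
by congr block_mx; congr (expR _ *: _); ring.
Qed.

Lemma img_mprod (c : atlas M1) (d : atlas M2) (u : 'rV[R]_(n1 + n2)) :
  img c (lsubmx u) -> img d (rsubmx u) -> img (M := mprod M1 M2) (c, d) u.
Proof.
move=> [x cx xu] [y dy yu]; exists (x, y) => //=.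
by rewrite xu yu hsubmxK.
Qed.

Section Slice.
Variable x : M1.
Local Notation c1 := (chart_at x).
Local Notation u1 := (chart c1 x).

Let c1x : dom c1 x. Proof. exact: mfd_cover. Qed.
Let img1 : img c1 u1. Proof. exact: img_chart. Qed.
Let o1 : open (img c1). Proof. exact: mfd_img_open. Qed.
Let o2 c : open (img (M := M2) c). Proof. exact: mfd_img_open. Qed.

Let shift0 : shift x u1 = 0.
Proof. by rewrite /shift /= (mfd_chartK M1_mfd c1x) subrr. Qed.

Let shift_smooth : smooth_on (img c1) (shift x).
Proof.
apply: smooth_onB; [exact: mfd_img_open | exact: k1_smooth |].
by apply: smooth_on_cst; exact: mfd_img_open.
Qed.

Let Z_split (c : atlas M2) u : img c1 (lsubmx u) /\ img c (rsubmx u) ->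
  Z (c1, c) u = row_mx (Z1 c1 (lsubmx u)) (Z2 c (rsubmx u)).
Proof.
move=> [u1i u2i]; rewrite Z_proj; last exact: img_mprod.
by rewrite /lift1 /lift2 add_row_mx addr0 add0r.
Qed.

Let slice (c : atlas M2) v : img c v ->
  let u := row_mx u1 v in img c1 (lsubmx u) /\ img c (rsubmx u).
Proof. by move=> cv; rewrite /= row_mxKl row_mxKr. Qed.

Lemma fiber_equation (c : atlas M2) v : img c v ->
  Ric (h2 x) c v + 2^-1 *: Lie Z2 (h2 x) c v =
  n1%:R *: (C2 c v + c2 (chart_inv c v) *: g2 c v)
  + (Phi x (chart_inv c v) - vapply Z1 k1 x
     + (expR (2 * s2 (chart_inv c v)))^-1 * a1 x) *: h2 x c v.
Proof.
move=> cv; have Wu := slice cv; set u := row_mx u1 v in Wu.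
have [Wl Wr] := Wu.
have sS : smooth_on (img c) (s2 \o chart_inv c) by exact: s2_smooth.
have sK : smooth_on (img c1) (k1 \o chart_inv c1) by exact: k1_smooth.
apply/matrixP => a b.
have := soliton.2 (c1, c) u (img_mprod Wl Wr).
rewrite /tscale -[Ric gL _ _]/(ric (gL (c1, c)) u) -[Lie Z gL _ _]/(lie (Z (c1, c)) (gL (c1, c)) u).
rewrite lyra_metricE => /matrixP/(_ (rshift n1 a) (rshift n1 b)).
rewrite mxE [X in _ + X]mxE [in RHS]mxE.
rewrite (ric_warped o1 (o2 (c := c)) (@pseudo_metric_smooth _ _ _ _ g1_metric c1)
  (@fiber_metric_smooth _ _ _ M2_mfd _ _ _ g2_metric k2_smooth s2_smooth (k1 x) c)
  (@pseudo_metric_sym _ _ _ _ g1_metric c1) (@fiber_metric_sym _ _ _ _ _ _ g2_metric (k1 x) c)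
  (@pseudo_metric_unit _ _ _ _ g1_metric c1) (@fiber_metric_unit _ _ _ _ _ _ g2_metric (k1 x) c)
  shift_smooth sS a b Wu).
rewrite (lie_warped_rr _ _ o1 (o2 (c := c))
  (@fiber_metric_smooth _ _ _ M2_mfd _ _ _ g2_metric k2_smooth s2_smooth (k1 x) c)
  shift_smooth (Z_split (c := c)) a b Wu).
rewrite /doubly_warped block_mxEdr [in RHS]mxE row_mxKl row_mxKr shift0 mulr0 expR0.
rewrite /dprod (hess_subC o1 _ sK) // !(dd_subC _ sK) //.
have -> : chart_inv (c := mprod M1 M2) (c1, c) u = (x, chart_inv c v).
  by rewrite /= row_mxKl row_mxKr (mfd_chartK M1_mfd c1x).
have -> : \tr (invmx (g1 c1 u1) *m hess (g1 c1) (k1 \o chart_inv c1) u1) + n2%:R *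
    (dd (k1 \o chart_inv c1) u1 *m invmx (g1 c1 u1) *m
     (dd (k1 \o chart_inv c1) u1)^T) 0 0 = a1 x.
  by rewrite /base_scalar (inner_gradE M1_mfd (c := c1)).
rewrite -[(Z1 c1 u1 *m _) 0 0]/(vapply Z1 k1 x).
have := hess_fiber M2_mfd g2_metric k2_smooth s2_smooth (k1 x) cv.
move=> /matrixP/(_ a b) hE.
have {}hE : hess (h2 x c) (s2 \o chart_inv c) v a b
    + partial a (s2 \o chart_inv c) v * partial b (s2 \o chart_inv c) v
    = (C2 c v + c2 (chart_inv c v) *: g2 c v) a b.
  rewrite -hE [RHS]mxE; congr (_ + _).
  by rewrite [RHS]mxE big_ord1 ![in RHS]mxE.
rewrite hE.
have -> : (Ric (h2 x) c v + 2^-1 *: Lie Z2 (h2 x) c v) a b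
    = ric (h2 x c) v a b + 2^-1 * lie (Z2 c) (h2 x c) v a b.
  by rewrite [LHS]mxE [X in _ + X = _]mxE.
have mxE3 (A B : 'M[R]_n2) (p q : R) : (p *: A + q *: B) a b = p * A a b + q * B a b.
  by rewrite [LHS]mxE ![X in X + _]mxE ![X in _ + X = _]mxE.
rewrite mxE3 /=.
move: (ric _ _ _ _) (lie _ _ _ _ _) (vapply _ _ _) (a1 x) (h2 x c v a b).
move: ((C2 c v + c2 (chart_inv c v) *: g2 c v) a b) (expR _)^-1 (Phi x _) => H e P r l z A B E.
(* The fiber component of the soliton equation, solved for the slice terms. Here H is the component
   of C2 + c2 g2, B that of the slice metric, A = a1(x), z = Z1(k1) and e = e^(-2 s2). *)
have -> : r + 2^-1 * l = r - n1%:R * H - e * 1 * A * B + 2^-1 * (1 * (l + 2 * z * B))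
    + (n1%:R * H + e * A * B - z * B) by field.
by rewrite E; ring.
Qed.

Local Notation fiber_lhs :=
  (fun c u => Ric (h2 x) c u + 2^-1 *: Lie Z2 (h2 x) c u).

Let h2_smooth c : smooth_mx (img c) (h2 x c).
Proof. exact: fiber_metric_smooth. Qed.

Let h2_unit c u : img c u -> h2 x c u \in unitmx.
Proof. exact: fiber_metric_unit. Qed.

(** Twice the divergence of Z2 for the slice metric, read in the preferred charts. It serves only to
    be eliminated between [scal_lyra] and [scal_fiber]. *)
Let div2 (y : M2) : R := trace (h2 x) (Lie Z2 (h2 x)) y.

(* Comparing traces in the charts [chart_at] makes the smoothness of
   [scal (h2 x)], up to the factor [rho], a consequence of that of [lam]. *)
Lemma scal_lyra y : scal gL (x, y) = (n1 + n2)%:R * Phi x y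
  - 2^-1 * (\tr (invmx (g1 c1 u1) *m lie (Z1 c1) (g1 c1) u1)
     + n1%:R * (2 * vapply Z2 s2 y) + (div2 y + n2%:R * (2 * vapply Z1 k1 x))).
Proof.
set c := chart_at y; set v := chart c y; pose u : 'rV[R]_(n1 + n2) := row_mx u1 v.
have cy : dom c y by exact: mfd_cover.
have cv : img c v by exact: img_chart.
have Wu := slice cv; have [Wl Wr] := Wu.
have sS : smooth_on (img c) (s2 \o chart_inv c) by exact: s2_smooth.
have sK : smooth_on (img c1) (k1 \o chart_inv c1) by exact: k1_smooth.
have Gu : gL (c1, c) u \in unitmx.
  rewrite lyra_metricE /doubly_warped block_diag_mx_unit.
  rewrite !unitmxZ ?unitfE ?gt_eqF ?mulr_gt0 ?expR_gt0 //.
  by rewrite (pseudo_metric_unit g1_metric Wl) (pseudo_metric_unit g2_metric Wr).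
have := soliton.2 (c1, c) u (img_mprod Wl Wr).
have -> : tscale (fun p => lam p + rho * scal gL p) gL (c1, c) u = Phi x y *: gL (c1, c) u.
  rewrite /tscale /= row_mxKl row_mxKr (mfd_chartK M1_mfd c1x).
  by rewrite (mfd_chartK M2_mfd cy).
move=> /(trace_soliton_mx Gu).
rewrite -[\tr (_ *m Ric _ _ _)]/(scal gL (x, y)).
rewrite -[Lie Z gL _ _]/(lie (Z (c1, c)) (gL (c1, c)) u) lyra_metricE.
rewrite (trace_lie_warped o1 (o2 (c := c)) (@pseudo_metric_smooth _ _ _ _ g1_metric c1)
  (@h2_smooth c) (@pseudo_metric_unit _ _ _ _ g1_metric c1) (@h2_unit c)
  shift_smooth sS (Z_split (c := c)) Wu).
by rewrite row_mxKl row_mxKr (dd_subC _ sK).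
Qed.

(** The expected value of lambda_(2,x) + rho R_h, the full factor on the right of the slice
    equation. *)
Definition inherited (gamma : M2 -> R) (y : M2) : R :=
  Phi x y - vapply Z1 k1 x + expR (- (2 * s2 y)) * (f (x, y) ^- 2)
    * (n1%:R * gamma y + n1%:R * c2 y + f (x, y) ^+ 2 * a1 x).

Lemma h2E c v : h2 x c v =
  (f (x, chart_inv c v) ^+ 2 * expR (2 * s2 (chart_inv c v))) *: g2 c v.
Proof.
rewrite /fiber_metric /tscale f_exp -expRM_natl -!expRD.
by congr (expR _ *: _); ring.
Qed.

Lemma fiber_proportional gamma : field_eq C2 (tscale gamma g2) ->
  field_eq fiber_lhs (tscale (inherited gamma) (h2 x)).
Proof.
move=> C2g c v cv; rewrite fiber_equation // C2g // /tscale !h2E.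
rewrite -scalerDl !scalerA -scalerDl; congr (_ *: _).
rewrite /inherited expRN.
have f0 : f (x, chart_inv c v) != 0 by rewrite gt_eqF.
have e0 : expR (2 * s2 (chart_inv c v)) != 0 by rewrite gt_eqF ?expR_gt0.
move: (vapply _ _ _) (a1 x) (Phi x _) => z A P.
by field; rewrite e0 f0.
Qed.

Lemma conformal_of_fiber nu : field_eq fiber_lhs (tscale nu (h2 x)) ->
  exists gamma : M2 -> R, field_eq C2 (tscale gamma g2).
Proof.
(* The slice equation solved for C2: the known multiples of h are subtracted, h is rewritten as f^2
   e^(2 s2) g2, and the result is divided by n1 > 0. *)
move=> hnu; exists (fun y => n1%:R^-1 * ((nu y - (Phi x y - vapply Z1 k1 x
  + (expR (2 * s2 y))^-1 * a1 x)) * (f (x, y) ^+ 2 * expR (2 * s2 y))) - c2 y).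
have n10 : n1%:R != 0 :> R by rewrite pnatr_eq0 -lt0n.
move=> c v cv; have := hnu c v cv; rewrite fiber_equation // /tscale.
move=> /(canRL (addrK _)); rewrite -scalerBl h2E scalerA => E.
rewrite scalerBl; apply: (canRL (addrK _)).
by rewrite -scalerA -E scalerA mulVf // scale1r.
Qed.

Lemma inherited_smooth gamma : field_eq C2 (tscale gamma g2) ->
  smooth_fun (inherited gamma).
Proof.
move=> C2g; apply: (smooth_proportionality M2_mfd n2_gt0 h2_smooth h2_unit _
  (fiber_proportional C2g)) => c.
exact: soliton_tensor_smooth.
Qed.

Lemma scal_fiber nu y : field_eq fiber_lhs (tscale nu (h2 x)) ->
  scal (h2 x) y = n2%:R * nu y - 2^-1 * div2 y.
Proof.
move=> hnu; have yv := img_chart (mfd_cover M2_mfd y).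
rewrite /scal /trace (trace_soliton_mx (h2_unit yv) (hnu _ _ yv)).
by rewrite (mfd_chartK M2_mfd (mfd_cover M2_mfd y)).
Qed.

Let lam_slice_smooth : smooth_fun (fun y => lam (x, y)).
Proof.
move=> c; have := soliton.1 (c1, c).
move=> /(smooth_on_slice (u0 := u1) (o2 (c := c))) sl.
apply: (eq_smooth_on (o2 (c := c)) _ (sl _)) => [v vc|v cv].
  by rewrite /= row_mxKl row_mxKr (mfd_chartK M1_mfd c1x).
by have [] := slice cv; exact: img_mprod.
Qed.

(** Subtracting [scal_lyra] from [scal_fiber] removes [div2]; multiplying by rho and replacing rho
    R^L by Phi - lambda leaves smooth functions only. *)
Lemma rho_scal_fiber_smooth gamma : field_eq C2 (tscale gamma g2) ->
  smooth_fun (fun y => rho * scal (h2 x) y).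
Proof.
move=> C2g; have smu := inherited_smooth C2g.
have sg : smooth_fun gamma.
  apply: (smooth_proportionality M2_mfd n2_gt0 (@pseudo_metric_smooth _ _ _ _ g2_metric)
    (@pseudo_metric_unit _ _ _ _ g2_metric) _ C2g) => c.
  exact: conformal_tensor_smooth.
have sc2 : smooth_fun c2 by exact: conformal_scalar_smooth.
have sZs : smooth_fun (vapply Z2 s2) by exact: smooth_vapply.
have scst a : smooth_fun (fun _ : M2 => a) by exact: smooth_fun_cst.
pose e y : R := expR (-2 * s2 y + -2 * (k1 x + k2 y)).
have se : smooth_fun e.
  apply: smooth_fun_expR => //; apply: smooth_funD => //; apply: smooth_funM => //.
  exact: smooth_funD.
pose e' y : R := expR (-2 * s2 y).
have se' : smooth_fun e' by apply: smooth_fun_expR => //; exact: smooth_funM.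
(* Phi recovered from the definition of [inherited]. The factors e^(-2 s2) f^-2 and e^(-2 s2) are
   written as exponentials of smooth functions on the fiber. *)
pose Psi y := inherited gamma y + vapply Z1 k1 x
  - (e y * (n1%:R * (gamma y + c2 y)) + e' y * a1 x).
have sPsi : smooth_fun Psi.
  apply: smooth_funB => //; first exact: smooth_funD.
  apply: smooth_funD => //; apply: smooth_funM => //; apply: smooth_funM => //.
  exact: smooth_funD.
have PsiE y : Psi y = Phi x y.
  have eE : e y = expR (- (2 * s2 y)) * f (x, y) ^- 2.
    rewrite /e f_exp -expRM_natl -expRN -expRD; congr (expR _); ring.
  have eE' : e' y = expR (- (2 * s2 y)) by congr (expR _); ring.
  have f0 : f (x, y) != 0 by rewrite gt_eqF.
  rewrite /Psi /inherited eE eE'.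
  move: (vapply _ _ _) (a1 x) (Phi x _) (expR _) => z A P E; field; exact: f0.
pose t1 := \tr (invmx (g1 c1 u1) *m lie (Z1 c1) (g1 c1) u1).
suff -> : (fun y => rho * scal (h2 x) y) = fun y => rho * (n2%:R * inherited gamma y)
    - (rho * ((n1 + n2)%:R * Psi y - (2^-1 * t1 + n1%:R * vapply Z2 s2 y
         + n2%:R * vapply Z1 k1 x)) - (Psi y - lam (x, y))).
  apply: smooth_funB => //; first by do 2!apply: smooth_funM => //.
  apply: smooth_funB => //; last exact: smooth_funB.
  apply: smooth_funM => //; apply: smooth_funB => //; first exact: smooth_funM.
  by do 2!apply: smooth_funD => //; exact: smooth_funM.
apply/funext => y; rewrite (scal_fiber y (fiber_proportional C2g)) PsiE.
have -> : Phi x y - lam (x, y) = rho * scal gL (x, y) by rewrite addrC addKr.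
rewrite [in X in _ = _ - (_ - X)]scal_lyra -/t1.
move: (inherited _ _) (div2 y) (vapply Z1 _ _) (vapply Z2 _ _) t1 (Phi x y) => I d z1 z2 t P.
by field.
Qed.

(** The slice tensor is already known to be [inherited] times h. Taking traces and dividing by n2 >
    0 shows that no other factor is possible, which determines the soliton function. *)
Lemma fiber_soliton gamma lam2 : field_eq C2 (tscale gamma g2) ->
  almost_RB_soliton (h2 x) Z2 lam2 rho <->
  forall y, lam2 y = inherited gamma y - rho * scal (h2 x) y.
Proof.
move=> C2g; have hi := fiber_proportional C2g.
have n20 : n2%:R != 0 :> R by rewrite pnatr_eq0 -lt0n.
split=> [[_ hl] y|lamE].
  have := trace_tscale M2_mfd y h2_unit hl.
  by rewrite (trace_tscale M2_mfd y h2_unit hi) => /(mulfI n20) ->; rewrite addrK.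
have {lamE}-> : lam2 = fun y => inherited gamma y - rho * scal (h2 x) y.
  exact/funext.
split.
  apply: smooth_funB => //; first exact: inherited_smooth.
  exact: rho_scal_fiber_smooth C2g.
by move=> c v cv; rewrite hi // /tscale subrK.
Qed.

End Slice.
End LyraSoliton.

Theorem theorem4p2 (R : realType) (n1 n2 : nat)
  (n1_gt0 : (0 < n1)%N) (n2_gt0 : (0 < n2)%N)
  (M1 : charted R n1) (M2 : charted R n2)
  (M1_mfd : smooth_manifold M1) (M2_mfd : smooth_manifold M2)
  (g1 : tensor02 M1) (g2 : tensor02 M2)
  (g1_metric : pseudo_metric g1) (g2_metric : pseudo_metric g2)
  (f phi : mprod M1 M2 -> R)
  (f_smooth : smooth_fun f) (phi_smooth : smooth_fun phi)
  (f_gt0 : forall p, 0 < f p) (phi_gt0 : forall p, 0 < phi p)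
  (Z : vfield (mprod M1 M2)) (Z1 : vfield M1) (Z2 : vfield M2)
  (Z_vfield : is_vfield Z) (Z1_vfield : is_vfield Z1) (Z2_vfield : is_vfield Z2)
  (Z_proj : projectable Z Z1 Z2)
  (lam : mprod M1 M2 -> R) (rho : R)
  (k1 : M1 -> R) (k2 sigma2 : M2 -> R)
  (k1_smooth : smooth_fun k1) (k2_smooth : smooth_fun k2)
  (sigma2_smooth : smooth_fun sigma2)
  (k_split : forall (x : M1) (y : M2), ln (f (x, y)) = k1 x + k2 y)
  (sigma_split : forall (x : M1) (y : M2), ln (phi (x, y)) = sigma2 y) :
  let gL := lyra_metric g1 g2 f phi in
  almost_RB_soliton gL Z lam rho ->
  let h2 (x : M1) : tensor02 M2 :=
    tscale (fun y => expR (2 * k1 x) * expR (2 * (k2 y + sigma2 y))) g2 in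
  let C2 : tensor02 M2 := fun c u =>
    Hess g2 sigma2 c u
    - (otimes (dif k2) (dif sigma2) c u + otimes (dif sigma2) (dif k2) c u)
    - otimes (dif sigma2) (dif sigma2) c u in
  let c2 (y : M2) : R :=
    inner g2 (grad g2 k2) (grad g2 sigma2) y
    + inner g2 (grad g2 sigma2) (grad g2 sigma2) y in
  let a1 (x : M1) : R :=
    Lap g1 k1 x + n2%:R * inner g1 (grad g1 k1) (grad g1 k1) x in
  (forall x : M1,
     (exists lam2 : M2 -> R, almost_RB_soliton (h2 x) Z2 lam2 rho)
     <-> field_eq (tracefree g2 C2) (fun _ _ => 0)) /\
  (forall gamma2 : M2 -> R, field_eq C2 (tscale gamma2 g2) ->
     forall (x : M1) (lam2 : M2 -> R),
     almost_RB_soliton (h2 x) Z2 lam2 rho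
     <-> forall y : M2,
       lam2 y = lam (x, y) + rho * (scal gL (x, y) - scal (h2 x) y)
                - vapply Z1 k1 x
                + expR (- (2 * sigma2 y)) * (f (x, y) ^- 2)
                  * (n1%:R * gamma2 y + n1%:R * c2 y + f (x, y) ^+ 2 * a1 x)).
Proof.
move=> gL soliton h2 C2 c2 a1.
have C2P : field_eq (tracefree g2 C2) (fun _ _ => 0) <->
    exists gamma : M2 -> R, field_eq C2 (tscale gamma g2).
  exact (tracefree_eq0 M2_mfd C2 n2_gt0 (@pseudo_metric_unit _ _ _ _ g2_metric)).
have solP x gamma lam2 : field_eq C2 (tscale gamma g2) ->
    almost_RB_soliton (h2 x) Z2 lam2 rho <-> forall y, lam2 y =
      inherited g1 g2 f phi Z1 lam rho k1 k2 sigma2 x gamma y - rho * scal (h2 x) y.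
  exact: (fiber_soliton n2_gt0 M1_mfd M2_mfd g1_metric g2_metric f_gt0 phi_gt0
    Z2_vfield Z_proj k1_smooth k2_smooth sigma2_smooth k_split sigma_split soliton).
split=> [x|gamma C2g x lam2].
  rewrite C2P; split=> [[lam2 [_ hl]]|[gamma C2g]].
    (* This direction uses the tensor equation of the slice soliton alone. *)
    exact: (conformal_of_fiber n1_gt0 M1_mfd M2_mfd g1_metric g2_metric f_gt0 phi_gt0
      Z_proj k1_smooth k2_smooth sigma2_smooth k_split sigma_split soliton hl).
  (* Unification with the characterization in [solP] supplies the witness, [inherited] minus rho
     R_h. *)
  by eexists; apply/(solP x gamma).
rewrite (solP x gamma) //; split=> E y; rewrite E /inherited.
all: rewrite -/gL -[conformal_scalar g2 k2 sigma2 y]/(c2 y) -[X in _ ^+ 2 * X]/(a1 x).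
all: ring.
Qed.
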